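(* There exists a family of complex numbers $(c(n))_{n\in\mathbb{Z}}$, not all zero, such that the trigonometric series $\sum_{n\in\mathbb{Z}} c(n)e^{int}$ converges to $0$ for almost every $t\in\mathbb{T}=\mathbb{R}/2\pi\mathbb{Z}$, and $$\sum_{n<0}|c(n)|^{2}<\infty .$$
   Context: $\mathbb{T}=\mathbb{R}/2\pi\mathbb{Z}$ is the circle, and ''almost every'' refers to Lebesgue measure. A nontrivial trigonometric series (i.e. one whose coefficients are not all zero) $\sum_{n\in\mathbb{Z}} c(n)e^{int}$ that converges to zero almost everywhere is called a null series. Convergence of the two-sided series at $t$ means convergence of the symmetric partial sums $\sum_{|n|\le N}c(n)e^{int}$ as $N\to\infty$. *)

(* Defs.v *)
From HB Require Import structures.
From mathcomp Require Import all_boot all_order all_algebra.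
From mathcomp Require Import complex.
From mathcomp Require Import all_classical all_reals all_analysis.

Set Implicit Arguments.
Unset Strict Implicit.
Unset Printing Implicit Defensive.

Import Order.TTheory GRing.Theory Num.Theory.
Import numFieldNormedType.Exports.

Local Open Scope classical_set_scope.
Local Open Scope ring_scope.
Local Open Scope complex_scope.

Definition expi (R : realType) (x : R) : R[i] := cos x +i* sin x.

(* The index k - N runs through the integers n with |n| <= N. *)
Definition sym_partial_sum (R : realType) (c : int -> R[i]) (t : R) (N : nat)
    : R[i] :=
  \sum_(k < N.*2.+1)
    c (k%:Z - N%:Z) * expi ((k%:Z - N%:Z)%:~R * t).

(* The topology on R[i] is the one given by its norm, which the library puts on
   the regular algebra R[i]^o. *)
Definition trig_series_cvg (R : realType) (c : int -> R[i]) (t : R) (s : R[i])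
    : Prop :=
  (sym_partial_sum c t : nat -> R[i]^o) @ \oo --> (s : R[i]^o).

(* R/2piZ is identified with its fundamental domain [0, 2pi[. *)
Definition ae_circle (R : realType) (P : R -> Prop) : Prop :=
  {ae (@lebesgue_measure R), forall t, t \in `[0, 2 * pi[ -> P t}.

Definition null_series (R : realType) (c : int -> R[i]) : Prop :=
  (exists n : int, c n != 0) /\ ae_circle (fun t => trig_series_cvg c t 0).

(* Main.v *)
Require Import Defs.
From HB Require Import structures.
From mathcomp Require Import all_boot all_order all_algebra.
From mathcomp Require Import complex.
From mathcomp Require Import all_classical all_reals all_analysis.
From mathcomp Require Import zify ring lra.

(** The series is obtained by iterating one step ([step]) that replaces a
    trigonometric polynomial [S] by a longer one, [S'], which is tiny except on a
    small set.  Let [tau_a = 2 * pi * a / G] be equally spaced nodes and [Th] a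
    positive kernel shaped like a tent of half-width [2 * pi / G], whose translates
    to the nodes sum to one ([exists_localized_kernel]).  When [G] is large, [S] is
    close to [sum_a S(tau_a) Th(t - tau_a)], and
      [S'(t) = S(t) + sum_a S(tau_a) Th(t - tau_a) (Y_a(m_a t) - 1)]
    is close to the same sum with [Y_a(m_a t)] inserted.  Here the [m_a] are very
    lacunary and [Y_a] is a trigonometric polynomial of mean one, tiny outside a
    short arc around the origin.  At each [t] only a few nodes matter, so [S'] is
    tiny outside a set whose measure is proportional to the length of that arc,
    whatever [G] is ([resonance_set], [new_value_le]).

    The point is the choice of [Y_a].  If [|S(tau_a)| > r], take [Y_a] analytic,
    namely a large power of [1 + c p] where [p] is the analytic half of a kernel
    ([exists_analytic_multiplier]): its coefficients are huge, but all the new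
    frequencies are positive.  If [|S(tau_a)| <= r], take for [Y_a] a kernel
    normalized to mean one ([exists_bounded_multiplier]): it has negative
    frequencies, but the sum of its coefficients is at most a number [g] related
    only to the length of the arc, not to the smallness of [Y_a] outside it.  The
    new negative frequencies then have squared norm at most [r^2 g]
    ([sum_neg_increment]).

    It remains to control partial sums at a point where [|S(t)| <= r / 2]
    ([partial_sum_le]).  The nodes near [t] are of the second kind, and their
    complete blocks contribute [O(r g)].  The nodes of the first kind are far from
    [t], where [Th], and also every truncation of its Fourier series, tends to zero
    as [G] grows; truncations are geometric sums, because [Th] is an average of
    translates of a Fejer kernel.  Finally a partial sum cuts at most two blocks,
    and the coefficients of [Th] sum to at most one.

    At stage [k] take [g] of order [2^k], hence an exceptional set of measure
    [O(2^-k)], then [r_k] of order [2^-k / g], and ask that [|S'| <= r_(k+1) / 2]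
    off the exceptional set.  By the Borel-Cantelli lemma, at almost every [t] all
    late stages are small and so are the partial sums between them, while the
    constant coefficient is [1] throughout. *)

Set Implicit Arguments.
Unset Strict Implicit.
Unset Printing Implicit Defensive.

Import Order.TTheory GRing.Theory Num.Theory.
Import numFieldNormedType.Exports.

Local Open Scope classical_set_scope.
Local Open Scope ring_scope.
Local Open Scope complex_scope.

(** * Modulus and exponentials *)

Section Modulus.
Variable R : realType.
Implicit Types (z w : R[i]) (x y t : R).

Notation nm := (@Normc.normc R).

Lemma nm_ge0 z : 0 <= nm z.
Proof. by case: z => a b; exact: sqrtr_ge0. Qed.

Lemma nmD z w : nm (z + w) <= nm z + nm w.
Proof. exact: (@le_normcD R). Qed.

Lemma nmN z : nm (- z) = nm z.
Proof. exact: (@normcN R). Qed.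

Lemma nmM z w : nm (z * w) = nm z * nm w.
Proof. exact: Normc.normcM. Qed.

Lemma nm0 : nm 0 = 0. Proof. exact: Normc.normc0. Qed.

Lemma nm1 : nm 1 = 1. Proof. exact: Normc.normc1. Qed.

Lemma nmX z n : nm (z ^+ n) = nm z ^+ n.
Proof. by elim: n => [|n IH]; rewrite ?expr0 ?nm1// !exprS nmM IH. Qed.

Lemma nmB z w : nm (z - w) <= nm z + nm w.
Proof. by rewrite -(nmN w); exact: nmD. Qed.

Lemma nmC z w : nm (z - w) = nm (w - z).
Proof. by rewrite -nmN opprB. Qed.

Lemma nmB_le z w : nm z - nm w <= nm (z - w).
Proof. by rewrite lerBlDr -{1}(subrK w z); exact: nmD. Qed.

Lemma nm_sqr z : nm z ^+ 2 = complex.Re z ^+ 2 + complex.Im z ^+ 2.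
Proof. by case: z => a b /=; rewrite sqr_sqrtr// addr_ge0// sqr_ge0. Qed.

Lemma nm_real x : nm x%:C = `|x|.
Proof. by rewrite /= expr0n addr0 sqrtr_sqr. Qed.

Lemma normCE z : `|z| = (nm z)%:C.
Proof. by rewrite normc_def; case: z. Qed.

Lemma nm_conj_mul z : z * z^* = (nm z ^+ 2)%:C.
Proof. by rewrite -sqr_normc normCE rmorphXn. Qed.

Lemma nm_sum (I : Type) (s : seq I) (P : pred I) (F : I -> R[i]) :
  nm (\sum_(i <- s | P i) F i) <= \sum_(i <- s | P i) nm (F i).
Proof.
elim/big_rec2: _ => [|i x z _ H]; first by rewrite nm0.
by apply: le_trans (nmD _ _) _; rewrite lerD2l.
Qed.

Lemma realC_sum (I : Type) (s : seq I) (P : pred I) (F : I -> R) :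
  (\sum_(i <- s | P i) F i)%:C = \sum_(i <- s | P i) (F i)%:C.
Proof. exact: (rmorph_sum (@real_complex R)). Qed.

Lemma realCM x y : (x * y)%:C = x%:C * y%:C.
Proof. exact: (rmorphM (@real_complex R)). Qed.

Lemma realC_nat n : (n%:R : R)%:C = n%:R.
Proof. exact: (rmorph_nat (@real_complex R)). Qed.

Lemma nm_nat n : nm n%:R = n%:R.
Proof. by rewrite -realC_nat nm_real ger0_norm. Qed.

Lemma realC_inj x y : x%:C = y%:C -> x = y.
Proof. by case. Qed.

Lemma expi0 : expi (0 : R) = 1.
Proof. by rewrite /expi cos0 sin0. Qed.

Lemma expiD x y : expi (x + y) = expi x * expi y.
Proof. by rewrite /expi cosD sinD; simpc; congr (_ +i* _); ring. Qed.

Lemma expiN x : expi (- x) = (expi x)^*.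
Proof. by rewrite /expi cosN sinN. Qed.

Lemma nm_expi x : nm (expi x) = 1.
Proof. by rewrite /= cos2Dsin2 sqrtr1. Qed.

Lemma expi_natl n x : expi (n%:R * x) = expi x ^+ n.
Proof.
elim: n => [|n IH]; first by rewrite mul0r expi0.
by rewrite -natr1 mulrDl mul1r expiD IH exprSr.
Qed.

Lemma expi2pi : expi (2 * pi : R) = 1.
Proof. by rewrite /expi mulrC mulr_natr cos2pi sin2pi. Qed.

Lemma expi_int2pi (w : int) : expi (w%:~R * (2 * pi : R)) = 1.
Proof.
case: w => n; first by rewrite -pmulrn expi_natl expi2pi expr1n.
by rewrite NegzE mulrNz mulNr expiN -pmulrn expi_natl expi2pi expr1n conjc1.
Qed.

Lemma expi_period (n w : int) x :
  expi (n%:~R * (x + w%:~R * (2 * pi))) = expi (n%:~R * x).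
Proof.
by rewrite mulrDr expiD mulrA -intrM expi_int2pi mulr1.
Qed.

Definition chord x : R := nm (1 - expi x).

Lemma chord_sqr x : chord x ^+ 2 = 2 - 2 * cos x.
Proof.
rewrite /chord nm_sqr /= sub0r sqrrN.
rewrite sin2cos2; ring.
Qed.

Lemma chord_ge0 x : 0 <= chord x.
Proof. exact: nm_ge0. Qed.

Lemma chord_le x y : cos y <= cos x -> chord x <= chord y.
Proof.
move=> h; rewrite -ler_sqr ?nnegrE ?chord_ge0// !chord_sqr; lra.
Qed.

Lemma chord_gt0 x : 0 < x -> x <= pi -> 0 < chord x.
Proof.
move=> x0 xpi; rewrite lt_def chord_ge0 andbT -sqrf_eq0 chord_sqr.
have h : cos x < cos 0.
  by rewrite ltr_cos// in_itv /= ?lexx ?pi_ge0 ?(ltW x0).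
by rewrite cos0 in h; apply/eqP; lra.
Qed.

Lemma sin_le x : 0 <= x -> sin x <= x.
Proof.
move=> x0; have [->|xn0] := eqVneq x 0; first by rewrite sin0.
have {x0 xn0} x0 : 0 < x by rewrite lt_neqAle eq_sym xn0.
have [c _] := @MVT R sin cos 0 x x0 (fun y _ => is_derive_sin y)
  (continuous_subspaceT (@continuous_sin R)).
rewrite sin0 !subr0 => ->.
by rewrite ler_piMl ?(ltW x0) ?cos_le1.
Qed.

Lemma chord_lip x : chord x <= `|x|.
Proof.
rewrite -ler_sqr ?nnegrE ?chord_ge0// chord_sqr -cos_norm.
set y := `|x|; have y0 : 0 <= y by exact: normr_ge0.
have -> : cos y = cos ((y / 2) *+ 2) by rewrite -mulr_natr mulfVK ?pnatr_eq0.
rewrite cos_mulr2n cos2sin2.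
have h : `|sin (y / 2)| <= y / 2.
  have h2 : 0 <= y / 2 by rewrite divr_ge0.
  have [h3|h3] := ler0P (sin (y/2)); last exact: sin_le.
  have [y2|y2] := leP (y/2) pi.
    have : 0 <= sin (y/2) by apply: sin_ge0_pi; rewrite h2 y2.
    move=> h4; have -> : sin (y/2) = 0 by apply/le_anti/andP.
    by rewrite oppr0.
  rewrite (le_trans _ (ltW y2))// (le_trans _ (pi_ge2 R))//.
  by rewrite lerNl (le_trans _ (sin_geN1 _))// lerN2 ler1n.
have : `|sin (y / 2)| ^+ 2 <= (y / 2) ^+ 2 by rewrite ler_sqr ?nnegrE ?divr_ge0.
rewrite real_normK ?num_real// => h1; rewrite mulr2n; move: h1;
 rewrite [(y / 2) ^+ 2]expr_div_n; set s := sin _ ^+ 2; lra.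
Qed.

Lemma nm_expiB x y : nm (expi x - expi y) = chord (x - y).
Proof.
have -> : expi x - expi y = - expi y * (1 - expi (x - y)).
  have e : expi x = expi (x - y) * expi y by rewrite -expiD subrK.
  by rewrite mulNr mulrBr mulr1 opprB [expi y * _]mulrC -e.
by rewrite nmM nmN nm_expi mul1r.
Qed.

(** Distances on the circle, kept on the line: the quantifier over the turns [w]
    avoids choosing a representative of [x] modulo [2 * pi]. *)
Definition far x (rho : R) := forall w : int, rho <= `|x - w%:~R * (2 * pi)|.

Lemma chord_far x (rho : R) : 0 <= rho -> rho <= pi -> far x rho -> chord rho <= chord x.
Proof.
move=> r0 rpi fx.
have p0 := pi_gt0 R.
(* [w] turns bring [x] into [-pi, pi], where the cosine is monotone in the modulus. *)
pose w := Num.floor ((x + pi) / (2 * pi)).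
have := floor_itv ((x + pi) / (2 * pi)).
rewrite -/w ler_pdivlMr ?mulr_gt0// ltr_pdivrMr ?mulr_gt0// intrD => /andP[h1 h2].
set y := x - w%:~R * (2 * pi).
have cy : cos x = cos y.
  have := expi_period 1 w y; rewrite subrK !mul1r => -[-> _] //.
apply: chord_le; rewrite cy -(cos_norm y).
have yr : rho <= `|y| := fx w.
have ypi : `|y| <= pi by rewrite ler_norml /y; apply/andP; split; lra.
by rewrite leNgt ltr_cos ?in_itv /= ?r0 ?rpi ?normr_ge0 ?ypi// -leNgt.
Qed.

Lemma farW x (r1 r2 : R) : r1 <= r2 -> far x r2 -> far x r1.
Proof. by move=> h f w; apply: le_trans (f w). Qed.

Lemma far_shift x y (r1 r2 : R) : far x r1 -> `|y| <= r2 -> far (x + y) (r1 - r2).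
Proof.
move=> f h w; apply: le_trans (lerB (f w) h) _.
have -> : x + y - w%:~R * (2 * pi) = (x - w%:~R * (2 * pi)) - (- y) by ring.
by rewrite -(normrN y); exact: lerB_dist.
Qed.

Lemma not_far x (rho : R) : ~ far x rho ->
  exists w : int, `|x - w%:~R * (2 * pi)| < rho.
Proof.
by move=> /existsNP[w /negP]; rewrite -ltNge => h; exists w.
Qed.

End Modulus.

(** * Symmetric sums and Dirichlet sums *)

Section SymSum.

Definition symsum (V : nmodType) (D : nat) (f : int -> V) : V :=
  \sum_(k < D.*2.+1) f (k%:Z - D%:Z).

Variable V : nmodType.
Implicit Types f : int -> V.

Lemma eq_symsum D f f' :
  (forall n, (`|n| <= D)%N -> f n = f' n) -> symsum D f = symsum D f'.
Proof. by move=> e; apply: eq_bigr => k _; apply: e; have := ltn_ord k; lia. Qed.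

Lemma symsum_eq0 D f :
  (forall n, (`|n| <= D)%N -> f n = 0) -> symsum D f = 0.
Proof. by move=> f0; apply: big1 => k _; apply: f0; have := ltn_ord k; lia. Qed.

Lemma symsumD D f f' :
  symsum D (fun n => f n + f' n) = symsum D f + symsum D f'.
Proof. exact: big_split. Qed.

Lemma symsum_exchange (I : finType) D (F : I -> int -> V) :
  symsum D (fun n => \sum_i F i n) = \sum_i symsum D (F i).
Proof. exact: exchange_big. Qed.

Lemma symsum_swap D D' (F : int -> int -> V) :
  symsum D (fun n => symsum D' (F n)) = symsum D' (fun l => symsum D (F^~ l)).
Proof. exact: exchange_big. Qed.

Lemma symsum_delta D (x : int) (v : V) :
  symsum D (fun n => if n == x then v else 0) = if (`|x| <= D)%N then v else 0.
Proof.
case: ifPn => h; last first.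
  by apply: big1 => k _; case: eqP => // e; have := ltn_ord k; lia.
have hk : (`|(x + D%:Z)%R| < D.*2.+1)%N by lia.
rewrite /symsum (bigD1 (Ordinal hk)) //= big1 ?addr0.
  by case: eqP => // e; case: e; lia.
by move=> k kn; case: eqP => // e; case/eqP: kn; apply: val_inj => /=; lia.
Qed.

Lemma symsum0 f : symsum 0 f = f 0.
Proof. by rewrite /symsum big_ord1 subr0. Qed.

Lemma symsumS D f :
  symsum D.+1 f = symsum D f + (f D.+1%:Z + f (- D.+1%:Z)).
Proof.
rewrite /symsum doubleS big_ord_recr big_ord_recl /= sub0r.
rewrite [f (- _) + _]addrC -addrA; congr (_ + _).
  by apply: eq_bigr => k _; congr f; rewrite /bump /=; lia.
by rewrite addrC; congr (f _ + f _); lia.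
Qed.

Lemma symsum_widen D D' f : (D <= D')%N -> (forall n, (D < `|n|)%N -> f n = 0) ->
  symsum D' f = symsum D f.
Proof.
move=> /subnK <- f0; elim: (D' - D)%N => [//|k IH].
by rewrite addSn symsumS IH !f0 ?addr0 //; lia.
Qed.

End SymSum.

Lemma ler_symsum (R : realType) D (f f' : int -> R) :
  (forall n, (`|n| <= D)%N -> f n <= f' n) -> symsum D f <= symsum D f'.
Proof. by move=> e; apply: ler_sum => k _; apply: e; have := ltn_ord k; lia. Qed.

Lemma symsum_ge0 (R : realType) D (f : int -> R) :
  (forall n, 0 <= f n) -> 0 <= symsum D f.
Proof. by move=> e; apply: sumr_ge0. Qed.

Lemma symsum_term_le (R : realType) D (f : int -> R) j :
  (forall n, 0 <= f n) -> (`|j| <= D)%N -> f j <= symsum D f.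
Proof.
move=> f0 hj; have := symsum_delta D j (f j); rewrite hj => <-.
by apply: ler_symsum => n _; case: eqP => [->|].
Qed.

Lemma symsumZ (S : pzRingType) (x : S) D (f : int -> S) :
  symsum D (fun n => x * f n) = x * symsum D f.
Proof. by rewrite /symsum mulr_sumr. Qed.

Lemma symsumZr (S : pzRingType) (x : S) D (f : int -> S) :
  symsum D (fun n => f n * x) = symsum D f * x.
Proof. by rewrite /symsum mulr_suml. Qed.

Lemma nm_symsum (R : realType) D (f : int -> R[i]) :
  Normc.normc (symsum D f) <= symsum D (fun n => Normc.normc (f n)).
Proof. exact: nm_sum. Qed.

Lemma sum_ord_mul (V : nmodType) (F : nat -> V) g H :
  \sum_(i < g * H) F i = \sum_(a < g) \sum_(p < H) F (a * H + p)%N.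
Proof.
elim: g => [|g IH]; first by rewrite mul0n !big_ord0.
by rewrite mulSn addnC big_split_ord /= IH big_ord_recr.
Qed.

Lemma sumr_ordc (S : pzRingType) n (x : S) : \sum_(i < n) x = n%:R * x.
Proof. by rewrite sumr_const card_ord mulr_natl. Qed.

Section Dirichlet.
Variable R : realType.
Notation nm := (@Normc.normc R).
Implicit Types (x y t : R).

Definition dirichlet n x : R[i] := \sum_(b < n) expi (b%:R * x).

Lemma dirichletE n x : dirichlet n x * (1 - expi x) = 1 - expi (n%:R * x).
Proof.
rewrite /dirichlet; elim: n => [|n IH].
  by rewrite big_ord0 !mul0r expi0 subrr.
have -> : expi (n.+1%:R * x) = expi (n%:R * x) * expi x.
  by rewrite -expiD -natr1 mulrDl mul1r.
by rewrite big_ord_recr /= mulrDl IH mulrBr mulr1 addrA subrK.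
Qed.

Lemma dirichlet_chord n x : nm (dirichlet n x) * chord x <= 2.
Proof.
rewrite /chord -nmM dirichletE (le_trans (nmB _ _))// nm1 nm_expi; lra.
Qed.

Lemma dirichlet_le n x : nm (dirichlet n x) <= n%:R.
Proof.
rewrite (le_trans (nm_sum _ _ _))// (eq_bigr (fun=> 1)) => [|i _]; last exact: nm_expi.
by rewrite sumr_const card_ord.
Qed.

Lemma dirichlet0 n : dirichlet n 0 = n%:R.
Proof.
rewrite /dirichlet (eq_bigr (fun=> 1)) => [|i _]; last by rewrite mulr0 expi0.
by rewrite sumr_const card_ord.
Qed.

Lemma nm_dirichletN n x : nm (dirichlet n (- x)) = nm (dirichlet n x).
Proof.
have -> : dirichlet n (- x) = (dirichlet n x)^*.
  by rewrite /dirichlet rmorph_sum; apply: eq_bigr => i _; rewrite mulrN expiN.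
by case: (dirichlet n x) => a b /=; rewrite sqrrN.
Qed.

Lemma nm_dirichlet_sqr n x : (nm (dirichlet n x) ^+ 2)%:C =
  \sum_(p < n) \sum_(q < n) expi ((p%:Z - q%:Z)%:~R * x).
Proof.
rewrite -nm_conj_mul /dirichlet rmorph_sum mulr_suml; apply: eq_bigr => p _.
rewrite mulr_sumr; apply: eq_bigr => q _.
have -> : (p%:Z - q%:Z)%:~R * x = p%:R * x + - (q%:R * x) by rewrite intrB mulrBl.
by rewrite expiD expiN.
Qed.

(** Windows of Fourier coefficients of a Fejer kernel are averages of such runs of
    consecutive terms of a geometric series.  A run telescopes after
    multiplication by [1 - expi y]; clamping the index to the window by [cl] makes
    the terms outside it telescope to nothing. *)
Lemma window_chord n (u v c : int) y : (u <= v)%R ->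
  nm (\sum_(b < n) if (u <= b%:Z - c)%R && (b%:Z - c <= v)%R
                   then expi ((b%:Z - c)%:~R * y) else 0) * chord y <= 2.
Proof.
move=> uv; rewrite /chord -nmM mulr_suml.
pose cl (k : int) : int := if (k < u)%R then u else if (v < k)%R then v + 1 else k.
pose e (k : int) : R[i] := expi ((cl k)%:~R * y).
rewrite (eq_bigr (fun b : 'I_n => e (b%:Z - c) - e (b.+1%:Z - c))); last first.
  move=> b _; rewrite /e /cl; case: ifPn => hb.
    have -> : (b%:Z - c < u)%R = false by lia.
    have -> : (v < b%:Z - c)%R = false by lia.
    have -> : (b.+1%:Z - c < u)%R = false by lia.
    have -> : (if (v < b.+1%:Z - c)%R then v + 1 else b.+1%:Z - c) = b%:Z - c + 1.
      by case: ifPn => ?; lia.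
    by rewrite mulrBr mulr1 -expiD (intrD _ (b%:Z - c)) mulrDl mul1r.
  rewrite mul0r; case: (ltrP (b%:Z - c) u) => h1.
    have [h2|h2] := ltrP (b.+1%:Z - c) u; first by rewrite subrr.
    have -> : (v < b.+1%:Z - c)%R = false by lia.
    by rewrite (_ : b.+1%:Z - c = u) ?subrr//; lia.
  have -> : (v < b%:Z - c)%R by lia.
  have -> : (b.+1%:Z - c < u)%R = false by lia.
  have -> : (v < b.+1%:Z - c)%R by lia.
  by rewrite subrr.
rewrite -(big_mkord xpredT (fun b => e (b%:Z - c) - e (b.+1%:Z - c))).
rewrite (eq_bigr (fun b => - (e (b.+1%:Z - c) - e (b%:Z - c)))) => [|i _]; last by rewrite opprB.
rewrite sumrN (telescope_sumr (fun b : nat => e (b%:Z - c))) // nmN.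
by rewrite (le_trans (nmB _ _))// !nm_expi; lra.
Qed.

(** The [M]-th roots of unity sum to zero: [n] is not a multiple of [M], so the
    ratio of the geometric sum stays away from [1]. *)
Lemma root_sum0 M (n : int) : (0 < `|n|)%N -> (`|n| < M)%N ->
  dirichlet M (n%:~R * (2 * pi / M%:R)) = 0.
Proof.
move=> n0 nM; have M0 : (0 : R) < M%:R by rewrite ltr0n; lia.
have p0 := pi_gt0 R.
set h := 2 * pi / M%:R.
have h0 : 0 < h by rewrite /h divr_gt0// mulr_gt0.
have hpi : h <= pi.
  by rewrite /h ler_pdivrMr// mulrC ler_pM2l// (ler_nat _ 2); lia.
have hM : 2 * pi = M%:R * h by rewrite /h mulrCA divff ?mulr1// gt_eqF.
have fx : far (n%:~R * h) h.
  move=> w; rewrite hM.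
  have -> : n%:~R * h - w%:~R * (M%:R * h) = (n - w * M%:Z)%:~R * h.
    by rewrite intrB intrM -pmulrn; ring.
  have nw : n != w * M%:Z.
    apply/eqP => e; have : (M%:Z %| n)%Z by apply/dvdzP; exists w.
    by rewrite dvdzE /= => /(dvdn_leq n0); lia.
  rewrite normrM (gtr0_norm h0) ler_peMl ?(ltW h0)// -intr_norm (ler_int _ 1); lia.
have c0 := lt_le_trans (chord_gt0 h0 hpi) (chord_far (ltW h0) hpi fx).
have := dirichletE M (n%:~R * h).
rewrite (_ : M%:R * (n%:~R * h) = n%:~R * (2 * pi)); last by rewrite hM; ring.
rewrite expi_int2pi subrr => /eqP; rewrite mulf_eq0 => /orP[/eqP//|/eqP e].
by move: c0; rewrite /chord e nm0 ltxx.
Qed.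

(** Orthogonality of the characters modulo [M]: only the diagonal terms of the
    squared modulus survive the summation over the nodes. *)
Lemma sum_dirichlet_sqr M y : (0 < M)%N ->
  \sum_(i < M) nm (dirichlet M (y - i%:R * (2 * pi / M%:R))) ^+ 2 = M%:R ^+ 2.
Proof.
move=> M0; apply: realC_inj; rewrite realC_sum.
under eq_bigr do rewrite nm_dirichlet_sqr.
rewrite exchange_big /=; under eq_bigr do rewrite exchange_big /=.
rewrite (eq_bigr (fun p : 'I_M => M%:R)); last first.
  move=> p _; rewrite (bigD1 p) //= [X in _ + X]big1 ?addr0.
    under eq_bigr do rewrite subrr mul0r expi0.
    by rewrite sumr_const card_ord.
  move=> q qp.
  rewrite (eq_bigr (fun i : 'I_M => expi ((p%:Z - q%:Z)%:~R * y) *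
     expi (i%:R * ((q%:Z - p%:Z)%:~R * (2 * pi / M%:R))))); last first.
    move=> i _; rewrite -expiD; congr expi; rewrite !intrB; ring.
  rewrite -mulr_sumr -/(dirichlet _ _) root_sum0 ?mulr0//.
    by have : (q : nat) != p by []; lia.
  by have := ltn_ord p; have := ltn_ord q; lia.
rewrite sumr_const card_ord rmorphXn /= rmorph_nat expr2 mulr_natr //.
Qed.

End Dirichlet.

(** * Localized positive kernels *)

Section Kernel.
Variable R : realType.
Notation nm := (@Normc.normc R).
Implicit Types (x y t : R).

(** A stand-in for the tent function of half-width [2 * pi / g], with [Th] the
    values and [theta] the Fourier coefficients.  The bounds on the coefficients
    do not involve [kappa], so the values away from the origin can be made small
    for free.  The field [lk_window] controls every truncation of the Fourier
    series at a distance [rho] from the origin, uniformly in the window; it is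
    what makes partial sums local. *)
Record localized_kernel (g D : nat) (kappa : R) (theta : int -> R)
    (Th : R -> R) : Prop := LocalizedKernel {
  lk_ge0 : forall l, 0 <= theta l;
  lk_le : forall l, theta l <= g%:R^-1;
  lk_zero : theta 0 = g%:R^-1;
  lk_even : forall l, theta (- l) = theta l;
  lk_sum : symsum D theta <= 1;
  lk_eval : forall x, symsum D (fun l => (theta l)%:C * expi (l%:~R * x)) = (Th x)%:C;
  lk_val_ge0 : forall x, 0 <= Th x;
  lk_far : forall x, far x (4 * pi / g%:R) -> Th x <= kappa;
  lk_partition : forall x, \sum_(a < g) Th (x - a%:R * (2 * pi / g%:R)) = 1;
  lk_window : forall x rho (u v : int),
    4 * pi / g%:R <= rho -> rho <= pi -> far x rho -> u <= v ->
    nm (symsum D (fun l => if (u <= l) && (l <= v)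
                           then (theta l)%:C * expi (l%:~R * x) else 0))
      * chord (rho / 2) <= 2 / g%:R
}.

Section Construction.
Variables g H : nat.
Hypotheses (g2 : (2 <= g)%N) (H0 : (0 < H)%N).
Let M := (g * H)%N.
Let h : R := 2 * pi / M%:R.
Let K : R := (H%:R * M%:R ^+ 2)^-1.

Let M0 : (0 < M)%N. Proof. by rewrite muln_gt0 H0 andbT; lia. Qed.
Let gR : (0 : R) < g%:R. Proof. by rewrite ltr0n; lia. Qed.
Let HR : (0 : R) < H%:R. Proof. by rewrite ltr0n. Qed.
Let MR : (0 : R) < M%:R. Proof. by rewrite ltr0n. Qed.
Let MgH : M%:R = g%:R * H%:R :> R. Proof. by rewrite natrM. Qed.
Let K0 : 0 < K. Proof. by rewrite invr_gt0 mulr_gt0// exprn_gt0. Qed.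
Let h0 : 0 < h. Proof. by rewrite divr_gt0// mulr_gt0// pi_gt0. Qed.
Let Hh : H%:R * h = 2 * pi / g%:R.
Proof. by rewrite /h MgH; field; rewrite !gt_eqF. Qed.

(** The tent is the discrete convolution of an indicator of [H] nodes with its
    reflection, smoothed by the Fejer kernel of order [M]; both have nonnegative
    coefficients, hence so does the product.  A Fejer kernel is handled as a
    squared Dirichlet sum, and [kcount l] counts the ways to write its frequency
    [l] as a difference. *)
Definition kcount (l : int) : R :=
  \sum_(c < M) \sum_(b < M) (if l == b%:Z - c%:Z then 1 else 0).

Definition ktheta (l : int) : R :=
  K * (kcount l * nm (dirichlet H (l%:~R * h)) ^+ 2).

Definition kval x : R :=
  K * \sum_(p < H) \sum_(q < H) nm (dirichlet M (x + (p%:Z - q%:Z)%:~R * h)) ^+ 2.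

Lemma kcount_ge0 l : 0 <= kcount l.
Proof. by apply: sumr_ge0 => c _; apply: sumr_ge0 => b _; case: ifP. Qed.

Lemma kcount_le l : kcount l <= M%:R.
Proof.
rewrite -[M in leRHS]card_ord -sumr_const; apply: ler_sum => c _.
have [hc|hc] := boolP ((0 <= l + c%:Z) && (l + c%:Z < M%:Z)).
  have hb : (`|(l + c%:Z)%R| < M)%N by lia.
  rewrite (bigD1 (Ordinal hb)) //= big1 ?addr0; first by case: ifP.
  move=> b bn; case: eqP => // e; case/eqP: bn; apply: val_inj => /=; lia.
rewrite big1 // => b _; case: eqP => // e; have := ltn_ord b; lia.
Qed.

Lemma kcount0 : kcount 0 = M%:R.
Proof.
rewrite -[M in RHS]card_ord -sumr_const; apply: eq_bigr => c _.
rewrite (bigD1 c) //= subrr eqxx big1 ?addr0 // => b bc.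
by case: eqP => // e; case/eqP: bc; apply: val_inj => /=; lia.
Qed.

Lemma kcountN l : kcount (- l) = kcount l.
Proof.
rewrite /kcount exchange_big /=; apply: eq_bigr => c _; apply: eq_bigr => b _.
by have -> : (- l == c%:Z - b%:Z) = (l == b%:Z - c%:Z) by lia.
Qed.

(** Opening all the squares turns any part of the Fourier series into an average
    of partial geometric sums. *)
Lemma kernel_window (P : pred int) x :
  symsum M (fun l => if P l then (ktheta l)%:C * expi (l%:~R * x) else 0) =
  K%:C * \sum_(p < H) \sum_(q < H) \sum_(c < M) \sum_(b < M)
    if P (b%:Z - c%:Z)
    then expi ((b%:Z - c%:Z)%:~R * (x + (p%:Z - q%:Z)%:~R * h)) else 0.
Proof.
pose F (p q : 'I_H) (c b : 'I_M) : R[i] := if P (b%:Z - c%:Z)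
    then expi ((b%:Z - c%:Z)%:~R * (x + (p%:Z - q%:Z)%:~R * h)) else 0.
transitivity (symsum M (fun l => K%:C * \sum_(p < H) \sum_(q < H) \sum_(c < M) \sum_(b < M)
                 (if l == b%:Z - c%:Z then F p q c b else 0))).
  apply: eq_symsum => l _; case: ifPn => Pl; last first.
    rewrite big1 ?mulr0 // => p _; rewrite big1 // => q _; rewrite big1 // => c _.
    by rewrite big1 // => b _; case: eqP => // e; rewrite /F -e (negPf Pl).
  rewrite /ktheta realCM [(kcount l * _)%:C]realCM -!mulrA; congr (_ * _).
  rewrite (nm_dirichlet_sqr _ (_ * _)) mulrCA mulr_suml.
  apply: eq_bigr => p _; rewrite mulr_suml; apply: eq_bigr => q _.
  rewrite mulrCA realC_sum mulr_suml; apply: eq_bigr => c _.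
  rewrite realC_sum mulr_suml; apply: eq_bigr => b _.
  case: eqP => [e|_]; last by rewrite mul0r.
  rewrite mul1r /F -e Pl -expiD; congr expi; ring.
rewrite symsumZ; congr (_ * _).
rewrite symsum_exchange; apply: eq_bigr => p _.
rewrite symsum_exchange; apply: eq_bigr => q _.
rewrite symsum_exchange; apply: eq_bigr => c _.
rewrite symsum_exchange; apply: eq_bigr => b _.
rewrite symsum_delta ifT //; have := ltn_ord b; have := ltn_ord c; lia.
Qed.

Lemma kval_eval x :
  symsum M (fun l => (ktheta l)%:C * expi (l%:~R * x)) = (kval x)%:C.
Proof.
have := kernel_window xpredT x => /= ->.
rewrite /kval realCM; congr (_ * _).
rewrite realC_sum; apply: eq_bigr => p _; rewrite realC_sum; apply: eq_bigr => q _.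
by rewrite nm_dirichlet_sqr exchange_big.
Qed.

Lemma kval_ge0 x : 0 <= kval x.
Proof.
rewrite /kval mulr_ge0 ?(ltW K0)//; apply: sumr_ge0 => p _.
by apply: sumr_ge0 => q _; exact: sqr_ge0.
Qed.

Lemma shift_le (p q : 'I_H) : `|(p%:Z - q%:Z)%:~R * h| <= 2 * pi / g%:R.
Proof.
rewrite -Hh normrM (gtr0_norm h0) ler_pM2r// -intr_norm.
by rewrite (ler_int _ _ H%:Z); have := ltn_ord p; have := ltn_ord q; lia.
Qed.

(** The [g] translates by multiples of [H] nodes, together with the [H] shifts
    inside one of them, run once through all the [M]-th roots of unity. *)
Lemma kval_partition x : \sum_(a < g) kval (x - a%:R * (2 * pi / g%:R)) = 1.
Proof.
rewrite /kval -mulr_sumr exchange_big /=.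
rewrite (eq_bigr (fun=> M%:R ^+ 2)); last first.
  move=> p _; rewrite -(@sum_dirichlet_sqr R M (x + p%:R * h)) //.
  pose F i := nm (dirichlet M (x + p%:R * h - i%:R * (2 * pi / M%:R))) ^+ 2.
  rewrite -[RHS]/(\sum_(i < g * H) F i) sum_ord_mul.
  apply: eq_bigr => a _; apply: eq_bigr => q _; congr (nm (dirichlet _ _) ^+ 2).
  rewrite -/M -/h -Hh intrB natrD natrM; ring.
rewrite sumr_ordc /K mulVf // mulf_neq0 ?gt_eqF ?exprn_gt0//.
Qed.

Lemma kernel_localized kappa :
  4 * H%:R / (M%:R ^+ 2 * chord (2 * pi / g%:R) ^+ 2) <= kappa ->
  localized_kernel g M kappa ktheta kval.
Proof.
move=> hk; have p0 := pi_gt0 R.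
have gpi : 2 * pi / g%:R <= pi :> R.
  by rewrite ler_pdivrMr// mulrC ler_pM2l// (ler_nat _ 2).
have gpi0 : (0 : R) < 2 * pi / g%:R by rewrite divr_gt0// mulr_gt0.
have c0 := chord_gt0 gpi0 gpi.
have KM : K * (M%:R * H%:R ^+ 2) = g%:R^-1.
  by rewrite /K MgH; field; rewrite !gt_eqF.
split.
- move=> l; rewrite /ktheta mulr_ge0 ?(ltW K0)// mulr_ge0 ?kcount_ge0//.
  exact: sqr_ge0.
- move=> l; rewrite -KM /ktheta ler_pM2l//.
  rewrite ler_pM ?kcount_ge0 ?kcount_le ?sqr_ge0//.
  by rewrite ler_sqr ?nnegrE ?nm_ge0 ?dirichlet_le.
- by rewrite -KM /ktheta kcount0 mul0r dirichlet0 nm_nat.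
- by move=> l; rewrite /ktheta kcountN intrN mulNr nm_dirichletN.
(* the coefficients sum to the value at the centre, one term of the partition *)
- have -> : symsum M ktheta = kval 0.
    apply: realC_inj; rewrite -kval_eval /symsum realC_sum.
    by apply: eq_bigr => k _; rewrite mulr0 expi0 mulr1.
  rewrite -(kval_partition 0) (bigD1 (Ordinal (ltnW g2))) //= mul0r subr0 lerDl.
  by apply: sumr_ge0 => a _; exact: kval_ge0.
- exact: kval_eval.
- exact: kval_ge0.
- move=> x fx; apply: le_trans hk.
  have hd (p q : 'I_H) : nm (dirichlet M (x + (p%:Z - q%:Z)%:~R * h)) ^+ 2 <=
      4 / chord (2 * pi / g%:R) ^+ 2.
    have := far_shift fx (shift_le p q).
    have -> : 4 * pi / g%:R - 2 * pi / g%:R = 2 * pi / g%:R :> R by ring.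
    move=> /(chord_far (ltW gpi0) gpi) h1.
    have -> : 4 / chord (2 * pi / g%:R) ^+ 2 = (2 / chord (2 * pi / g%:R)) ^+ 2 :> R.
      by rewrite expr_div_n -natrX.
    suff : nm (dirichlet M (x + (p%:Z - q%:Z)%:~R * h)) <= 2 / chord (2 * pi / g%:R).
      move=> hs; rewrite ler_sqr ?nnegrE ?nm_ge0//.
      by rewrite divr_ge0// ltW.
    rewrite ler_pdivlMr//.
    apply: le_trans (dirichlet_chord M (x + (p%:Z - q%:Z)%:~R * h)).
    by rewrite ler_wpM2l ?nm_ge0.
  have : kval x <= K * \sum_(p < H) \sum_(q < H) (4 / chord (2 * pi / g%:R) ^+ 2).
    rewrite /kval ler_pM2l//; apply: ler_sum => p _; apply: ler_sum => q _.
    exact: hd.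
  rewrite !sumr_ordc => /le_trans; apply.
  rewrite le_eqVlt; apply/orP; left; apply/eqP.
  by rewrite /K; field; rewrite !gt_eqF.
- exact: kval_partition.
- move=> x rho u v r1 r2 fx uv.
  have r0 : 0 < rho by apply: lt_le_trans r1; rewrite divr_gt0// mulr_gt0.
  rewrite (kernel_window (fun l => (u <= l) && (l <= v))) nmM nm_real (gtr0_norm K0).
  have -> : 2 / g%:R = K * \sum_(p < H) \sum_(q < H) \sum_(c < M) 2 :> R.
    rewrite !sumr_ordc -KM; ring.
  rewrite -mulrA ler_pM2l// (le_trans (ler_wpM2r (chord_ge0 _) (nm_sum _ _ _)))//.
  rewrite mulr_suml; apply: ler_sum => p _.
  rewrite (le_trans (ler_wpM2r (chord_ge0 _) (nm_sum _ _ _)))//.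
  rewrite mulr_suml; apply: ler_sum => q _.
  rewrite (le_trans (ler_wpM2r (chord_ge0 _) (nm_sum _ _ _)))//.
  rewrite mulr_suml; apply: ler_sum => c _.
  set y := x + _.
  have fy : far y (rho / 2).
    apply: farW (far_shift fx (shift_le p q)).
    have -> : 2 * pi / g%:R = (4 * pi / g%:R) / 2 :> R by field; rewrite gt_eqF.
    lra.
  apply: le_trans (window_chord M c%:Z y uv).
  by rewrite ler_wpM2l ?nm_ge0// chord_far//; lra.
Qed.

End Construction.

(** Away from the tent each squared Dirichlet sum is bounded, while the
    normalization grows with [H]: the values there are [O(1 / H)]. *)
Lemma exists_localized_kernel g kappa : (2 <= g)%N -> 0 < kappa ->
  exists D theta Th, localized_kernel g D kappa theta Th.
Proof.
move=> g2 k0.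
have p0 := pi_gt0 R.
have gR : (0 : R) < g%:R by rewrite ltr0n; lia.
have gpi : 2 * pi / g%:R <= pi :> R.
  by rewrite ler_pdivrMr// mulrC ler_pM2l// (ler_nat _ 2).
have gpi0 : (0 : R) < 2 * pi / g%:R by rewrite divr_gt0// mulr_gt0.
have c0 := chord_gt0 gpi0 gpi.
set ch := chord _ in c0.
pose X := 4 / (g%:R ^+ 2 * ch ^+ 2) / kappa.
have [n hn] : exists n : nat, X < n.+1%:R.
  exists (Num.truncn X); exact: Num.Theory.truncnS_gt.
exists (g * n.+1)%N, (ktheta g n.+1), (kval g n.+1); apply: kernel_localized => //.
rewrite -/ch natrM; have nR : (0 : R) < n.+1%:R by rewrite ltr0n.
have -> : 4 * n.+1%:R / ((g%:R * n.+1%:R) ^+ 2 * ch ^+ 2) =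
  X * kappa / n.+1%:R by rewrite /X; field; rewrite !gt_eqF.
by rewrite ler_pdivrMr// mulrC ler_pM2l// ltW.
Qed.

End Kernel.

(** * Analytic multipliers *)

Section Multipliers.
Variable R : realType.
Notation nm := (@Normc.normc R).
Implicit Types (x : R).

Lemma Re_sum (I : Type) (s : seq I) (P : pred I) (F : I -> R[i]) :
  complex.Re (\sum_(i <- s | P i) F i) = \sum_(i <- s | P i) complex.Re (F i).
Proof.
by elim/big_rec2: _ => // i z w _ <-; case: (F i) => ? ?; case: w.
Qed.

Lemma symsum_split (V : nmodType) D (f : int -> V) :
  symsum D f = f 0 + \sum_(i < D) (f i.+1%:Z + f (- i.+1%:Z)).
Proof.
elim: D => [|D IH]; first by rewrite symsum0 big_ord0 addr0.
by rewrite symsumS IH big_ord_recr /= -addrA.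
Qed.

Lemma symsum_analytic (V : nmodType) D (f : int -> V) :
  (forall j, (j < 0)%R -> f j = 0) -> symsum D f = \sum_(i < D.+1) f i%:Z.
Proof.
move=> f0; rewrite symsum_split big_ord_recl; congr (_ + _).
by apply: eq_bigr => i _; rewrite [f (- _)]f0 ?addr0.
Qed.

Lemma exists_expr_le (q d : R) : 0 <= q -> q < 1 -> 0 < d -> exists n, q ^+ n <= d.
Proof.
move=> q0 q1 d0.
have : (fun n => q ^+ n) @ \oo --> (0 : R) by apply: cvg_expr; rewrite ger0_norm.
move=> /cvgrPdist_le /(_ d d0) [n _ /(_ n (leqnn n))].
by rewrite /= sub0r normrN ger0_norm ?exprn_ge0// => h; exists n.
Qed.

(** Twice the analytic half of [g] times a localized kernel, without its mean,
    is a polynomial [p] whose real part is the kernel minus one, at most [-1/2]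
    away from the origin.  Hence [1 + c p] has modulus less than one there for
    small [c > 0], and a large power of it is as small as desired. *)
Lemma exists_analytic_multiplier g (delta : R) : (2 <= g)%N -> 0 < delta ->
  exists N (y : int -> R[i]),
  [/\ y 0 = 1, forall j, (j < 0)%R -> y j = 0, forall j, (N < `|j|)%N -> y j = 0 &
      forall x, far x (4 * pi / g%:R) ->
        nm (symsum N (fun j => y j * expi (j%:~R * x))) <= delta].
Proof.
move=> g2 d0; have gR : (0 : R) < g%:R by rewrite ltr0n; lia.
have k0 : (0 : R) < (2 * g%:R)^-1 by rewrite invr_gt0 mulr_gt0.
have [D [th [Th K]]] := exists_localized_kernel g2 k0.
pose p : {poly R[i]} := \poly_(i < D.+1) (if i == 0 then 0 else (2 * g%:R * th i%:Z)%:C).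
pose P := \sum_(i < D.+1) nm p`_i.
have P0 : 0 <= P by apply: sumr_ge0 => i _; exact: nm_ge0.
have hz x : nm p.[expi x] <= P.
  rewrite (horner_coef_wide _ (size_poly _ _)) (le_trans (nm_sum _ _ _))//.
  by apply: ler_sum => i _; rewrite nmM nmX nm_expi expr1n mulr1.
have hRe x : complex.Re p.[expi x] = g%:R * Th x - 1.
  rewrite (horner_coef_wide _ (size_poly _ _)) big_ord_recl coef_poly /= mul0r add0r.
  have := lk_eval K x; rewrite symsum_split mul0r expi0 mulr1 (lk_zero K).
  move=> /(congr1 (@complex.Re R)) /=; rewrite raddfD Re_sum /= => <-.
  rewrite mulrDr mulfV ?gt_eqF// addrC addKr Re_sum mulr_sumr; apply: eq_bigr => i _.
  rewrite coef_poly /bump /= add1n ltnS (ltn_ord i) -expi_natl (lk_even K).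
  rewrite intrN mulNr cosN -pmulrn /= !mul0r !subr0; ring.
(* with this [c] the quadratic term of [|1 + c p|^2] is at most half the gain *)
pose c : R := (2 * (P ^+ 2 + 1))^-1.
have P2 : 0 <= P ^+ 2 by exact: sqr_ge0.
have c0 : 0 < c by rewrite invr_gt0; lra.
have cP : c * (P ^+ 2 + 1) = 2^-1 by rewrite /c; field; lra.
pose q := 1 - c / 2.
have q0 : 0 <= q by rewrite /q; nra.
have q1 : q < 1 by rewrite /q; lra.
have [n hn] := exists_expr_le q0 q1 d0.
pose A := (1 + c%:C *: p) ^+ (2 * n).
pose y (j : int) : R[i] := match j with Posz i => A`_i | Negz _ => 0 end.
have hA x : symsum (size A) (fun j => y j * expi (j%:~R * x)) = A.[expi x].
  rewrite symsum_analytic => [|[|] //= j _]; last by rewrite mul0r.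
  rewrite (horner_coef_wide _ (leqnSn _)); apply: eq_bigr => i _.
  by rewrite -pmulrn expi_natl.
exists (size A), y; split => //.
- rewrite -[y 0]/(A`_0) -horner_coef0 /A horner_exp hornerD hornerZ hornerC.
  by rewrite horner_coef0 coef_poly mulr0 addr0 expr1n.
- by case.
- by case=> // j jN; rewrite /y nth_default// ltnW.
- move=> x fx; rewrite hA /A horner_exp nmX exprM.
  apply: le_trans hn; rewrite lerXn2r ?nnegrE ?sqr_ge0//.
  rewrite !hornerE nm_sqr.
  have := hRe x; have := hz x; have := nm_sqr p.[expi x].
  have : g%:R * Th x <= 2^-1.
    apply: le_trans (ler_wpM2l (ltW gR) (lk_far K fx)) _.
    by rewrite invfM mulrCA mulfV ?gt_eqF// mulr1.
  have := nm_ge0 p.[expi x].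
  case: p.[expi x] => u v /=; rewrite !mul0r subr0 add0r addr0; set m := Num.sqrt _.
  move=> m0 hT e mP eu.
  have m2 : m ^+ 2 <= P ^+ 2 by rewrite ler_sqr ?nnegrE.
  have -> : (1 + c * u) ^+ 2 + (c * v) ^+ 2 = 1 + 2 * (c * u) + c * (c * m ^+ 2).
    by rewrite e; ring.
  have h1 : c * u <= c * (- 2^-1) by rewrite ler_pM2l//; lra.
  have h2 : c * m ^+ 2 <= 2^-1.
    by rewrite -cP ler_pM2l//; lra.
  have h3 : c * (c * m ^+ 2) <= c * 2^-1 by rewrite ler_pM2l.
  rewrite /q; lra.
Qed.

End Multipliers.

(** * Adding separated blocks of frequencies *)

Section AtMostOne.
Variable R : realType.
Notation nm := (@Normc.normc R).

Lemma nm_sum_sqr_at_most_one (I : finType) (F : I -> R[i]) :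
  (forall i i', F i != 0 -> F i' != 0 -> i = i') ->
  nm (\sum_i F i) ^+ 2 = \sum_i nm (F i) ^+ 2.
Proof.
move=> h; case: (pickP (fun i => F i != 0)) => [i0 n0|e0]; last first.
  rewrite !big1 ?nm0 ?expr0n // => i _; first by move/negbFE/eqP: (e0 i) => ->; rewrite nm0 expr0n.
  by move/negbFE/eqP: (e0 i).
have z i : i != i0 -> F i = 0.
  by move=> ii0; apply/eqP; apply: contraNT ii0 => ni; apply/eqP/h.
rewrite (bigD1 i0) //= big1 ?addr0 => [|i /z //].
rewrite [RHS](bigD1 i0) //= big1 ?addr0 // => i /z ->.
by rewrite nm0 expr0n.
Qed.

Lemma sum_at_most_one_le (I : finType) (P : pred I) (X : I -> R) b : 0 <= b ->
  (forall i, P i -> X i <= b) -> (forall i i', P i -> P i' -> i = i') ->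
  \sum_(i | P i) X i <= b.
Proof.
move=> b0 hb h; case: (pickP P) => [i0 p0|e0]; last by rewrite big_pred0.
rewrite (bigD1 i0) //= big1 ?addr0 ?hb// => i /andP[Pi /eqP[]].
exact: h.
Qed.

End AtMostOne.

(** The exponent is determined because a nonzero multiplier is too short to
    absorb a factor [J + 1]. *)
Lemma lacunary_inj (J a a' : nat) (j j' : int) :
  j != 0 -> j' != 0 -> (`|j| <= J)%N -> (`|j'| <= J)%N ->
  j * (J.+1 ^ a)%N%:Z = j' * (J.+1 ^ a')%N%:Z -> a = a' /\ j = j'.
Proof.
wlog aa : a a' j j' / (a <= a')%N.
  move=> H jn j'n hj hj' e; case: (leqP a a') => [aa|/ltnW aa]; first exact: H.
  by case: (H a' a j' j) => // -> ->.
move=> jn j'n hj hj'; rewrite -(subnK aa) expnD PoszM mulrA => e.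
have {}e : j = j' * (J.+1 ^ (a' - a))%N%:Z.
  apply: (mulIf _ e); have : (0 < J.+1 ^ a)%N by rewrite expn_gt0.
  by rewrite -lt0n.
case: (posnP (a' - a)) => [z|pos].
  by rewrite e z expn0 mulr1; split => //; lia.
have : (J.+1 <= J.+1 ^ (a' - a))%N by rewrite -{1}(expn1 J.+1) leq_exp2l// ltnS; lia.
move: hj; rewrite e abszM /=; nia.
Qed.

Definition freq (m J a : nat) (j : int) : int := m%:Z * (j * (J.+1 ^ a)%N%:Z).

Lemma abs_freq m J a j : `|freq m J a j|%N = (m * (`|j| * J.+1 ^ a))%N.
Proof. by rewrite /freq !abszM. Qed.

Lemma freq_ge m J a j : j != 0 -> (m <= `|freq m J a j|)%N.
Proof.
by rewrite abs_freq -absz_gt0 => jn; rewrite leq_pmulr// muln_gt0 jn expn_gt0.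
Qed.

Lemma freq_pos m J a j : (0 < j)%R -> (m%:Z <= freq m J a j)%R.
Proof.
move=> j0; have := @freq_ge m J a j; rewrite gt_eqF// => /(_ isT).
have : (0 <= freq m J a j)%R by rewrite /freq !mulr_ge0// ltW.
lia.
Qed.

Lemma freq_sep m J a a' j j' :
  j != 0 -> j' != 0 -> (`|j| <= J)%N -> (`|j'| <= J)%N ->
  (`|(freq m J a j - freq m J a' j')%R| < m)%N -> a = a' /\ j = j'.
Proof.
move=> jn j'n hj hj' h; apply: (@lacunary_inj J) => //; apply/eqP.
rewrite -subr_eq0 -absz_eq0; move: h; rewrite /freq -mulrBr abszM absz_nat.
by case: `|_|%N => // x; rewrite mulnS ltnNge leq_addr.
Qed.

Lemma freq_le m J G (a : 'I_G) j : (`|j| <= J)%N ->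
  (`|freq m J a j| <= m * (J * J.+1 ^ G))%N.
Proof.
move=> hj; rewrite abs_freq leq_mul2l; apply/orP; right; apply: leq_mul => //.
by rewrite leq_pexp2l// ltnW.
Qed.

Lemma abs_window (x l : int) N :
  (`|(x + l)%R| <= N)%N = (- N%:Z - x <= l)%R && (l <= N%:Z - x)%R.
Proof. by lia. Qed.

Lemma window_nonempty (x : int) N : (- N%:Z - x <= N%:Z - x)%R.
Proof. by lia. Qed.

Lemma positive_block (p x : int) D m : (D.*2 < m)%N -> (`|x| <= D)%N ->
  (m%:Z <= p)%R -> (p + x < 0)%R = false.
Proof. by lia. Qed.

Lemma symsum_index_le D (k : 'I_(D.*2.+1)) : (`|(k%:Z - D%:Z)%R| <= D)%N.
Proof. by have := ltn_ord k; lia. Qed.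

Lemma block_low (p l : int) d D m : (d + D.*2 < m)%N -> (`|l| <= D)%N ->
  (m <= `|p|)%N -> (`|(p + l)%R| <= d)%N = false.
Proof. by lia. Qed.

Lemma block_abs (p l : int) D : (`|l| <= D)%N -> (`|(p + l)%R| <= `|p| + D)%N.
Proof. by lia. Qed.

Lemma block_above (p l : int) D N : (`|l| <= D)%N -> (N + D < `|p|)%N ->
  (N < `|(p + l)%R|)%N.
Proof. by lia. Qed.

Lemma centers_close (p q x y : int) D m : (D.*2 < m)%N ->
  (`|x| <= D)%N -> (`|y| <= D)%N -> p + x = q + y -> (`|(p - q)%R| < m)%N.
Proof. by lia. Qed.

Lemma partial_close (p q : int) N D m : (D.*2 < m)%N ->
  (`|p| <= N + D)%N -> (N < `|p| + D)%N -> (`|q| <= N + D)%N -> (N < `|q| + D)%N ->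
  (0 < p)%R = (0 < q)%R -> (`|(p - q)%R| < m)%N.
Proof. by lia. Qed.

Lemma freq_sgn m J a j : (0 < m)%N -> (0 < freq m J a j)%R = (0 < j)%R.
Proof.
move=> m0; rewrite /freq pmulr_rgt0 ?ltz_nat// pmulr_lgt0// ltz_nat.
by rewrite expn_gt0.
Qed.

Section Stage.
Variable R : realType.
Notation nm := (@Normc.normc R).
Implicit Types (x t : R).

(** The current polynomial [S] has coefficients [c]; it is sampled at the nodes
    [tau a], and its samples are spread by the kernel [Th].  A node is small when
    the modulus of its sample is at most [r]: it gets the multiplier [yK], whose
    coefficients are bounded independently of its values.  The other nodes get
    the analytic multiplier [yA]. *)
Variables (c : int -> R[i]) (d : nat) (s Lam r : R).
Let S t := sym_partial_sum c t d.
Hypothesis S_le : forall t, nm (S t) <= s.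
Hypothesis S_lip : forall t t', nm (S t - S t') <= Lam * `|t - t'|.
Hypothesis r0 : 0 < r.

Variables (G D : nat) (kappa : R) (theta : int -> R) (Th : R -> R).
Hypothesis G2 : (2 <= G)%N.
Hypothesis kappa0 : 0 <= kappa.
Hypothesis K : localized_kernel G D kappa theta Th.

Variables (J : nat) (yK yA : int -> R[i]) (B BA : R).
Hypotheses (yK0 : yK 0 = 1) (yA0 : yA 0 = 1).
Hypothesis yK_le1 : forall j, nm (yK j) <= 1.
Hypothesis yK_sum : symsum J (fun j => nm (yK j)) <= B.
Hypothesis yK_sumA : symsum J (fun j => nm (yK j)) <= BA.
Hypothesis yA_sum : symsum J (fun j => nm (yA j)) <= BA.
Hypothesis yA_neg : forall j, (j < 0)%R -> yA j = 0.

Variable m : nat.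
Hypothesis hm : (d + D.*2 < m)%N.

Let tau (a : nat) : R := a%:R * (2 * pi / G%:R).
Let small a := nm (S (tau a)) <= r.
Let y a j := if small a then yK j else yA j.
(* the multiplier minus its mean *)
Let z a j := if j == 0 then 0 else y a j.
Let phi (a : nat) (j : int) : int := freq m J a j.

(** The Fourier coefficients of
    [sum_a S (tau a) * Th (t - tau a) * (Y_a (m * (J + 1) ^ a * t) - 1)], where
    [Y_a] is the multiplier of the node [a].  The block [(a, j)] occupies the
    frequencies within [D] of [phi a j]. *)
Definition increment (n : int) : R[i] :=
  \sum_(a < G) symsum J (fun j => symsum D (fun l =>
    if n == phi a j + l
    then S (tau a) * z a j * ((theta l)%:C * expi (- (l%:~R * tau a))) else 0)).

Let W N t a j := symsum D (fun l => if (`|(phi a j + l)%R| <= N)%N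
    then (theta l)%:C * expi (l%:~R * (t - tau a)) else 0).

Let s0 : 0 <= s. Proof. exact: le_trans (nm_ge0 _) (S_le 0). Qed.
Let BA0 : 0 <= BA.
Proof. by apply: le_trans yA_sum; apply: symsum_ge0 => j; exact: nm_ge0. Qed.
Let GR : (0 : R) < G%:R. Proof. by rewrite ltr0n; exact: ltnW. Qed.

Lemma increment_low n : (`|n| <= d)%N -> increment n = 0.
Proof.
move=> nd; apply: big1 => a _; apply: symsum_eq0 => j hj; apply: symsum_eq0 => l hl.
case: eqP => // e; rewrite /z; case: eqP => [_|/eqP jn]; first by rewrite mulr0 mul0r.
by have := block_low hm hl (freq_ge m J a jn); rewrite -/(phi _ _) -e nd.
Qed.

Definition top_degree := (m * (J * J.+1 ^ G).+1 + D)%N.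

Lemma top_degree_gt : (d < top_degree)%N.
Proof. 
rewrite /top_degree mulnS -addnA; apply: leq_trans (leq_addr _ _).
by apply: leq_ltn_trans hm; exact: leq_addr. Qed.

Lemma phi_top (a : 'I_G) j : (`|j| <= J)%N -> (`|phi a j| + D <= top_degree)%N.
Proof.
move=> hj; rewrite leq_add2r; apply: leq_trans (freq_le _ _ hj) _.
by rewrite leq_mul2l leqnSn orbT.
Qed.

Lemma increment_high n : (top_degree < `|n|)%N -> increment n = 0.
Proof.
move=> nd; apply: big1 => a _; apply: symsum_eq0 => j hj; apply: symsum_eq0 => l hl.
case: eqP => // e; move: nd; rewrite e ltnNge.
by rewrite (leq_trans (block_abs _ hl) (phi_top a hj)).
Qed.

Lemma increment_window N t :
  symsum N (fun n => increment n * expi (n%:~R * t)) =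
  \sum_(a < G) symsum J (fun j => S (tau a) * z a j *
     (expi ((phi a j)%:~R * t) * W N t a j)).
Proof.
transitivity (symsum N (fun n => \sum_(a < G) symsum J (fun j => symsum D (fun l =>
    if n == phi a j + l then S (tau a) * z a j * (expi ((phi a j)%:~R * t) *
       ((theta l)%:C * expi (l%:~R * (t - tau a)))) else 0)))).
  apply: eq_symsum => n _; rewrite /increment mulr_suml; apply: eq_bigr => a _.
  rewrite -symsumZr; apply: eq_symsum => j _; rewrite -symsumZr.
  apply: eq_symsum => l _; case: eqP => [->|_]; last by rewrite mul0r.
  rewrite -!mulrA; do 2![congr (_ * _)]; rewrite [RHS]mulrCA; congr (_ * _).
  by rewrite -!expiD; congr expi; rewrite intrD; ring.
rewrite symsum_exchange; apply: eq_bigr => a _.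
rewrite symsum_swap; apply: eq_symsum => j _.
rewrite symsum_swap /W -!symsumZ; apply: eq_symsum => l _.
by rewrite symsum_delta; case: ifP; rewrite ?mulr0.
Qed.

Lemma window_full N t a j : (`|phi a j| + D <= N)%N -> W N t a j = (Th (t - tau a))%:C.
Proof.
move=> h; rewrite -(lk_eval K); apply: eq_symsum => l hl.
by rewrite ifT// (leq_trans (block_abs _ hl) h).
Qed.

Lemma window_empty N t a j : (N + D < `|phi a j|)%N -> W N t a j = 0.
Proof.
move=> h; apply: symsum_eq0 => l hl.
by rewrite ifN// -ltnNge; exact: block_above hl h.
Qed.

Lemma window_le1 N t a j : nm (W N t a j) <= 1.
Proof.
apply: le_trans (nm_symsum _ _) _; apply: le_trans (lk_sum K).
apply: ler_symsum => l _; case: ifP => _; last by rewrite nm0 (lk_ge0 K).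
by rewrite nmM nm_expi mulr1 nm_real ger0_norm// (lk_ge0 K).
Qed.

Lemma window_far N t a j rho : 4 * pi / G%:R <= rho -> rho <= pi ->
  far (t - tau a) rho -> nm (W N t a j) * chord (rho / 2) <= 2 / G%:R.
Proof.
move=> h1 h2 f.
have uv : - N%:Z - phi a j <= N%:Z - phi a j by exact: window_nonempty.
have := lk_window K h1 h2 f uv; congr (nm _ * _ <= _).
by apply: eq_symsum => l _; rewrite abs_window.
Qed.

(** Distinct triples [(a, j, l)] have distinct frequencies, so the square of a
    coefficient is a sum of squares.  Negative frequencies come from small nodes
    only; each of the [G] nodes then costs at most [r ^+ 2 * B / G], because the
    coefficients of the kernel are at most [1 / G] with sum at most one. *)
Lemma sum_neg_increment L :
  \sum_(k < L) nm (increment (Negz k)) ^+ 2 <= r ^+ 2 * B.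
Proof.
pose jj (j : 'I_(J.*2.+1)) : int := j%:Z - J%:Z.
pose ll (l : 'I_(D.*2.+1)) : int := l%:Z - D%:Z.
pose C (p : 'I_G * 'I_(J.*2.+1) * 'I_(D.*2.+1)) : R[i] :=
  S (tau p.1.1) * z p.1.1 (jj p.1.2) *
    ((theta (ll p.2))%:C * expi (- ((ll p.2)%:~R * tau p.1.1))).
pose f (p : 'I_G * 'I_(J.*2.+1) * 'I_(D.*2.+1)) : int := phi p.1.1 (jj p.1.2) + ll p.2.
have incE n : increment n = \sum_p (if n == f p then C p else 0).
  rewrite /increment /symsum (eq_bigr (fun a : 'I_G => \sum_(q : 'I_(J.*2.+1) * 'I_(D.*2.+1))
     (if n == f (a, q.1, q.2) then C (a, q.1, q.2) else 0))).
    rewrite pair_bigA /= (reindex (fun p : 'I_G * 'I_(J.*2.+1) * 'I_(D.*2.+1) =>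
      (p.1.1, (p.1.2, p.2)))) /=; last first.
      by exists (fun q => (q.1, q.2.1, q.2.2)) => [[[? ?] ?]|[? [? ?]]].
    by apply: eq_bigr => -[[? ?] ?].
  by move=> a _; rewrite pair_bigA.
have jjJ j : (`|jj j| <= J)%N by exact: symsum_index_le.
have llD l : (`|ll l| <= D)%N by exact: symsum_index_le.
have Cz p : C p != 0 -> jj p.1.2 != 0.
  by apply: contraNneq => e; rewrite /C /z e eqxx mulr0 mul0r.
have finj p p' : C p != 0 -> C p' != 0 -> f p = f p' -> p = p'.
  move=> /Cz hp /Cz hp' e.
  have [e1 e2] : nat_of_ord p.1.1 = p'.1.1 /\ jj p.1.2 = jj p'.1.2.
    apply: (@freq_sep m J) => //; apply: centers_close e => //.
    by apply: leq_ltn_trans hm; exact: leq_addl.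
  have e3 : ll p.2 = ll p'.2 by move: e; rewrite /f e1 e2 => /addrI.
  case: p p' {hp hp' e} e1 e2 e3 => [[a j] l] [[a' j'] l'] /= e1 e2 e3.
  have inj N (k k' : 'I_N) : k%:Z = k'%:Z -> k = k' by move=> [] /val_inj.
  by congr (_, _, _); apply: inj => //; [rewrite e1|exact: addIr e2|exact: addIr e3].
have -> : \sum_(k < L) nm (increment (Negz k)) ^+ 2 =
    \sum_p \sum_(k < L) (if Negz k == f p then nm (C p) ^+ 2 else 0).
  rewrite exchange_big; apply: eq_bigr => k _.
  rewrite incE nm_sum_sqr_at_most_one.
    by apply: eq_bigr => p _; case: ifP; rewrite ?nm0 ?expr0n.
  move=> p p'; case: ifP => [/eqP e|_]; last by rewrite eqxx.
  case: ifP => [/eqP e'|_]; last by rewrite eqxx.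
  by move=> h h'; apply: finj => //; rewrite -e.
have bnd p : \sum_(k < L) (if Negz k == f p then nm (C p) ^+ 2 else 0) <=
    r ^+ 2 * (nm (yK (jj p.1.2)) * (theta (ll p.2) / G%:R)).
  have rhs0 : 0 <= r ^+ 2 * (nm (yK (jj p.1.2)) * (theta (ll p.2) / G%:R)).
    by rewrite mulr_ge0 ?sqr_ge0// mulr_ge0 ?nm_ge0// divr_ge0 ?(lk_ge0 K)// ltW.
  have [neg|pos] := boolP (f p < 0)%R; last first.
    by rewrite big1 // => k _; case: eqP => // e; move: pos; rewrite -e.
  rewrite -big_mkcond; apply: sum_at_most_one_le => // [k _|k k' /eqP e /eqP e']; last first.
    by apply: val_inj; move: e; rewrite -e' => -[].
  have [->|Cn] := eqVneq (C p) 0; first by rewrite nm0 expr0n.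
  have jn := Cz _ Cn.
  have jneg : (jj p.1.2 < 0)%R.
    rewrite ltNge le_eqVlt negb_or eq_sym jn /=; apply/negP => jpos.
    have := freq_pos m J p.1.1 jpos; rewrite -/(phi _ _).
    move=> hp; have Dm : (D.*2 < m)%N by apply: leq_ltn_trans hm; exact: leq_addl.
    by move: neg; rewrite /f (positive_block Dm (llD p.2) hp).
  have sm : small p.1.1.
    apply: contraNT Cn => /negbTE sm.
    by rewrite /C /z /y sm (negbTE jn) yA_neg// mulr0 mul0r.
  rewrite /C /z (negbTE jn) /y sm !nmM nm_expi mulr1 nm_real (ger0_norm (lk_ge0 K _)).
  rewrite !exprMn -mulrA; apply: ler_pM; rewrite ?mulr_ge0 ?sqr_ge0 ?nm_ge0 ?(lk_ge0 K)//.
    by rewrite ler_sqr ?nnegrE ?nm_ge0// ltW.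
  apply: ler_pM; rewrite ?sqr_ge0//.
    by rewrite expr2 ler_piMl ?nm_ge0 ?yK_le1.
  by rewrite expr2 ler_wpM2l ?(lk_ge0 K) ?(lk_le K).
apply: le_trans (ler_sum _ (fun p _ => bnd p)) _.
rewrite -mulr_sumr ler_pM2l ?exprn_gt0//.
rewrite -(pair_bigA _ (fun p l => nm (yK (jj p.2)) * (theta (ll l) / G%:R))) /=.
rewrite -(pair_bigA _ (fun (a : 'I_G) j => \sum_l nm (yK (jj j)) * (theta (ll l) / G%:R))) /=.
rewrite sumr_ordc.
under eq_bigr do rewrite -mulr_sumr -mulr_suml.
rewrite -mulr_suml mulrCA; apply: le_trans yK_sum.
rewrite [G%:R * _]mulrCA mulfV ?gt_eqF// mulr1; apply: ler_piMr; last exact: (lk_sum K).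
by apply: sumr_ge0 => j _; exact: nm_ge0.
Qed.

Let Lam0 : 0 <= Lam.
Proof.
have := S_lip 0 1; rewrite sub0r normrN normr1 mulr1; apply: le_trans.
exact: nm_ge0.
Qed.

Let B0 : 0 <= B.
Proof. by apply: le_trans yK_sum; apply: symsum_ge0 => j; exact: nm_ge0. Qed.

Lemma S_periodic (w : int) t : S (t + w%:~R * (2 * pi)) = S t.
Proof. by apply: eq_bigr => k _; rewrite expi_period. Qed.

Lemma S_near t a rho : ~ far (t - tau a) rho -> nm (S t - S (tau a)) <= Lam * rho.
Proof.
move=> /not_far[w hw]; rewrite -(S_periodic w (tau a)).
apply: le_trans (S_lip _ _) _; rewrite ler_wpM2l// ltW//.
by rewrite opprD addrA.
Qed.

Lemma large_node_far t rho a : Lam * rho <= r / 2 -> nm (S t) <= r / 2 ->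
  ~~ small a -> far (t - tau a) rho.
Proof.
move=> h1 h2 /negP h3; apply: contrapT => /S_near h4; apply: h3.
have := nmB_le (S (tau a)) (S t); rewrite nmC /small => h5; lra.
Qed.

Lemma symsum_nm_z a : symsum J (fun j => nm (z a j)) <= if small a then B else BA.
Proof.
apply: (@le_trans _ _ (symsum J (fun j => nm (y a j)))).
  by apply: ler_symsum => j _; rewrite /z; case: eqP => // _; rewrite nm0 nm_ge0.
by rewrite /y; case: ifP.
Qed.

Let partial N a j := [&& j != 0, (`|phi a j| <= N + D)%N & (N < `|phi a j| + D)%N].

Lemma partial_unique N a a' j j' : (`|j| <= J)%N -> (`|j'| <= J)%N ->
  partial N a j -> partial N a' j' -> (0 < j)%R = (0 < j')%R -> a = a' /\ j = j'.
Proof.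
move=> hj hj' /and3P[jn h1 h2] /and3P[j'n h3 h4] sg.
apply: (@freq_sep m J) => //.
have Dm : (D.*2 < m)%N by apply: leq_ltn_trans hm; exact: leq_addl.
have [s1 s2] : (0 < j)%R = (0 < phi a j)%R /\ (0 < j')%R = (0 < phi a' j')%R.
  by split; symmetry; apply: freq_sgn; apply: leq_trans Dm.
by apply: partial_close Dm h1 h2 h3 h4 _; rewrite -s1 -s2.
Qed.

(** Where [S] is small, the nodes within [rho] of [t] are small nodes.  The
    complete blocks contribute at most [r * B] from these, and little from the
    other nodes because the kernel is tiny at a distance.  The truncation cuts at
    most two blocks, of opposite signs: at a small node such a piece is at most
    [r], since the kernel coefficients sum to at most one, and at the other nodes
    it is small because windows of the kernel are small at a distance. *)
Lemma partial_sum_le t N rho eps :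
  4 * pi / G%:R <= rho -> rho <= pi -> Lam * rho <= r / 2 ->
  G%:R * (s * kappa * BA) + 2 * (s * BA * (2 / G%:R / chord (rho / 2))) <= eps ->
  nm (S t) <= r / 2 ->
  nm (symsum N (fun n => increment n * expi (n%:~R * t))) <= r * (B + 2) + eps.
Proof.
move=> g1 g2 hL heps hS.
have rho0 : 0 < rho by apply: lt_le_trans g1; rewrite divr_gt0// mulr_gt0// pi_gt0.
have ch0 : 0 < chord (rho / 2) by apply: chord_gt0; lra.
set om := 2 / G%:R / chord (rho / 2) in heps.
have om0 : 0 <= om by rewrite /om !divr_ge0 ?ltW.
pose X := r + s * BA * om.
have sBo : 0 <= s * BA * om by apply: mulr_ge0 => //; exact: mulr_ge0.
have X0 : 0 <= X by apply: addr_ge0 => //; exact: ltW.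
have tb (a : 'I_G) j : (`|j| <= J)%N ->
   nm (S (tau a) * z a j * (expi ((phi a j)%:~R * t) * W N t a j)) <=
   nm (S (tau a)) * nm (z a j) * Th (t - tau a) + (if partial N a j then X else 0).
  move=> hj; rewrite !nmM nm_expi mul1r.
  have A0 : 0 <= nm (S (tau a)) * nm (z a j) by rewrite mulr_ge0 ?nm_ge0.
  have T0 : 0 <= nm (S (tau a)) * nm (z a j) * Th (t - tau a).
    by rewrite mulr_ge0 ?(lk_val_ge0 K).
  have [j0|jn] := eqVneq j 0.
    have Pj : partial N a j = false by rewrite /partial j0 eqxx.
    have zj : z a j = 0 by rewrite /z j0 eqxx.
    by rewrite zj Pj nm0 mulr0 !mul0r addr0.
  have [full|nfull] := leqP (`|phi a j| + D) N.
    by rewrite window_full// nm_real ger0_norm ?(lk_val_ge0 K)// lerDl; case: (partial N a j).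
  have [nempty|empty] := leqP `|phi a j| (N + D); last first.
    rewrite window_empty// nm0 mulr0; apply: addr_ge0 => //.
    by case: (partial N a j).
  have Pj : partial N a j by rewrite /partial jn nempty nfull.
  rewrite Pj.
  rewrite -[leLHS]add0r lerD// /X /z (negbTE jn) /y.
  have [sm|lg] := boolP (small a).
    apply: (@le_trans _ _ r); last by rewrite lerDl.
    rewrite -mulrA -[leRHS]mulr1; apply: ler_pM; rewrite ?mulr_ge0 ?nm_ge0//.
    by rewrite mulr_ile1 ?nm_ge0 ?window_le1.
  apply: (@le_trans _ _ (s * BA * om)); last by rewrite lerDr ltW.
  apply: ler_pM; rewrite ?mulr_ge0 ?nm_ge0//.
    apply: ler_pM; rewrite ?nm_ge0//.
    apply: le_trans yA_sum.
    by apply: (symsum_term_le (f := fun j => nm (yA j))) => // n; exact: nm_ge0.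
  by rewrite /om ler_pdivlMr//; apply: window_far => //; exact: large_node_far lg.
rewrite increment_window.
have h1 : \sum_(a < G) symsum J (fun j => nm (S (tau a)) * nm (z a j) * Th (t - tau a))
    <= r * B + G%:R * (s * kappa * BA).
  have -> : r * B = \sum_(a < G) r * B * Th (t - tau a).
    by rewrite -mulr_sumr (lk_partition K) mulr1.
  rewrite -sumr_ordc -big_split /=.
  apply: ler_sum => a _; rewrite symsumZr symsumZ.
  have T0 := lk_val_ge0 K (t - tau a); rewrite -/(tau a).
  have := symsum_nm_z a; have [sm|lg] := boolP (small a) => hz.
    rewrite -[leLHS]addr0; apply: lerD; last by rewrite !mulr_ge0.
    apply: ler_wpM2r => //; apply: ler_pM; rewrite ?nm_ge0 ?symsum_ge0// => j.
    exact: nm_ge0.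
  rewrite -[leLHS]add0r; apply: lerD; first by rewrite !mulr_ge0// ltW.
  rewrite mulrAC; apply: ler_pM => //.
  - by rewrite mulr_ge0 ?nm_ge0.
  - by apply: symsum_ge0 => j; exact: nm_ge0.
  apply: ler_pM; rewrite ?nm_ge0//; apply: (lk_far K); apply: farW g1 _.
  exact: large_node_far lg.
have h2 (b : bool) : \sum_(a < G) symsum J (fun j =>
      if partial N a j && ((0 < j)%R == b) then X else 0) <= X.
  rewrite /symsum pair_bigA -big_mkcond /=; apply: sum_at_most_one_le => //.
  move=> [a j] [a' j'] /= /andP[p1 /eqP e1] /andP[p2 /eqP e2].
  have hj (k : 'I_(J.*2.+1)) := symsum_index_le k.
  have [ea ej] := partial_unique (hj j) (hj j') p1 p2 (etrans e1 (esym e2)).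
  by congr (_, _); apply: val_inj => //=; move/addIr: ej => -[].
apply: le_trans (nm_sum _ _ _) _.
apply: (@le_trans _ _ (\sum_(a < G) symsum J (fun j =>
   nm (S (tau a)) * nm (z a j) * Th (t - tau a) +
   ((if partial N a j && ((0 < j)%R == true) then X else 0) +
    (if partial N a j && ((0 < j)%R == false) then X else 0))))).
  apply: ler_sum => a _; apply: le_trans (nm_symsum _ _) _.
  apply: ler_symsum => j hj; apply: le_trans (tb a j hj) _; rewrite lerD2l.
  by case: (partial N a j) => /=; case: (0 < j)%R => /=; rewrite ?addr0 ?add0r.
under eq_bigr do rewrite !symsumD.
rewrite !big_split /=.
have := h2 true; have := h2 false; rewrite /X; lra.
Qed.

Definition multiplier_value (yy : int -> R[i]) x := symsum J (fun j => yy j * expi (j%:~R * x)).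

Let xx (a : nat) t : R := (m * J.+1 ^ a)%N%:R * t.

Lemma increment_value t :
  symsum top_degree (fun n => increment n * expi (n%:~R * t)) =
  \sum_(a < G) (Th (t - tau a))%:C * (S (tau a) * (multiplier_value (y a) (xx a t) - 1)).
Proof.
rewrite increment_window; apply: eq_bigr => a _.
transitivity (symsum J (fun j => (Th (t - tau a))%:C * S (tau a) *
    (z a j * expi (j%:~R * xx a t)))).
  apply: eq_symsum => j hj; rewrite window_full ?phi_top//.
  have -> : (phi a j)%:~R * t = j%:~R * xx a t.
    rewrite /phi /freq /xx !intrM natrM -!pmulrn; ring.
  ring.
rewrite symsumZ -mulrA; congr (_ * (_ * _)); apply/eqP; rewrite eq_sym subr_eq; apply/eqP.
have := symsum_delta J 0 (1 : R[i]); rewrite /= => <-; rewrite -symsumD.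
apply: eq_symsum => j _; rewrite /z; case: eqP => [->|_]; last by rewrite addr0.
by rewrite mul0r expi0 mulr1 mul0r add0r /y; case: ifP.
Qed.

Lemma multiplier_value_le a x : nm (multiplier_value (y a) x) <= BA.
Proof.
apply: le_trans (nm_symsum _ _) _.
apply: (@le_trans _ _ (symsum J (fun j => nm (y a j)))).
  by apply: ler_symsum => j _; rewrite nmM nm_expi mulr1.
by rewrite /y; case: (small a).
Qed.

(** The samples reproduce [S], so that subtracting them leaves only the products
    with the multipliers.  Nodes far from [t] are damped by the kernel; at a node
    close to [t] the multiplier is small, unless its frequency resonates. *)
Lemma new_value_le t eta dR dA r' :
  (forall x, far x eta -> nm (multiplier_value yK x) <= dR) ->
  (forall x, far x eta -> nm (multiplier_value yA x) <= dA) ->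
  0 <= dR -> 0 <= dA ->
  Lam * (4 * pi / G%:R) + r * dR + s * dA + G%:R * (kappa * (s * (2 + BA))) <= r' ->
  (forall a, (a < G)%N -> far (t - tau a) (4 * pi / G%:R) \/ far (xx a t) eta) ->
  nm (S t + symsum top_degree (fun n => increment n * expi (n%:~R * t))) <= r'.
Proof.
move=> hR hA dR0 dA0 hr' hf; apply: le_trans hr'.
rewrite increment_value.
have -> : S t = \sum_(a < G) (Th (t - tau a))%:C * S t.
  by rewrite -mulr_suml -realC_sum (lk_partition K) mul1r.
rewrite -big_split /=; apply: le_trans (nm_sum _ _ _) _.
set Z := Lam * _ + _ + _.
have Z0 : 0 <= Z.
  by rewrite /Z !addr_ge0 ?mulr_ge0 ?invr_ge0 ?ler0n ?pi_ge0// ltW.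
have ZE : Z = \sum_(a < G) Z * Th (t - tau a).
  by rewrite -mulr_sumr (lk_partition K) mulr1.
rewrite ZE -sumr_ordc -big_split /=.
apply: ler_sum => a _; rewrite -mulrDr nmM nm_real ger0_norm ?(lk_val_ge0 K)//.
rewrite -/(tau a); have T0 := lk_val_ge0 K (t - tau a).
set Y := multiplier_value _ _.
have -> : S t + S (tau a) * (Y - 1) = (S t - S (tau a)) + S (tau a) * Y.
  by rewrite mulrBr mulr1 addrA addrAC.
have Sa := S_le (tau a); have St := S_le t; have Sa0 := nm_ge0 (S (tau a)).
have Y0 := nm_ge0 Y; have YB : nm Y <= BA by exact: multiplier_value_le.
have tri := nmD (S t - S (tau a)) (S (tau a) * Y); rewrite nmM in tri.
have [fa|nfa] := pselect (far (t - tau a) (4 * pi / G%:R)).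
  rewrite -[leLHS]add0r; apply: lerD; first by rewrite mulr_ge0.
  apply: ler_pM; rewrite ?nm_ge0 ?(lk_far K)//; apply: le_trans tri _.
  rewrite mulrDr; apply: lerD; first by have := nmB (S t) (S (tau a)); lra.
  exact: ler_pM.
have [//|fx] := hf a (ltn_ord a).
rewrite -[leLHS]addr0; apply: lerD; last by rewrite !mulr_ge0// addr_ge0.
rewrite mulrC; apply: ler_wpM2r => //; apply: le_trans tri _.
rewrite /Z -addrA; apply: lerD; first exact: S_near nfa.
rewrite /Y /y; case: (boolP (small a)) => sm.
  rewrite -[leLHS]addr0; apply: lerD; last by rewrite mulr_ge0.
  by apply: ler_pM; rewrite ?nm_ge0// hR.
rewrite -[leLHS]add0r; apply: lerD; first by rewrite mulr_ge0// ltW.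
by apply: ler_pM; rewrite ?nm_ge0// hA.
Qed.

End Stage.

(** * Resonances *)

Lemma turn_index (w : int) : (- 2 < w)%R -> (w < 2)%R ->
  (`|(w + 1)%R| < 3)%N /\ `|(w + 1)%R|%N%:Z - 1 = w.
Proof. by move=> ? ?; split; lia. Qed.

Lemma window_index (k i : int) q : (`|k| < q.*2.+1)%N -> i = k + q.*2%:Z + 1 ->
  (`|i| < 4 * q + 3)%N /\ `|i|%N%:Z = i.
Proof. by move=> ? ?; split; lia. Qed.

Section BadSet.
Variable R : realType.
Notation mu := (@lebesgue_measure R).
Implicit Types (t : R).

Lemma measurable_bigU n (A : nat -> set R) :
  (forall i, measurable (A i)) -> measurable (\big[setU/set0]_(i < n) A i).
Proof. by move=> mA; apply: bigsetU_measurable => i _; exact: mA. Qed.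

Lemma measure_bigU_le n (A : nat -> set R) (b : R) :
  (forall i, measurable (A i)) -> (forall i, (i < n)%N -> (mu (A i) <= b%:E)%E) ->
  (mu (\big[setU/set0]_(i < n) A i) <= (n%:R * b)%:E)%E.
Proof.
move=> mA hA; apply: le_trans (Boole_inequality _ _) _; first by move=> i _; exact: mA.
apply: (@le_trans _ _ (\sum_(i < n) b%:E)%E).
  by apply: lee_sum => i _; exact: hA.
by rewrite sumEFin lee_fin sumr_ordc.
Qed.

Definition itv_around (x h : R) : set R := [set` `[x - h, x + h]].

Lemma measure_itv_around (x h : R) : 0 <= h ->
  (mu (itv_around x h) <= (2 * h)%:E)%E.
Proof.
move=> h0; rewrite /itv_around lebesgue_measure_itv /=; case: ifP => _.
  by rewrite EFinN -EFinB lee_fin; lra.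
by rewrite lee_fin mulr_ge0.
Qed.

(** Within [4 * pi / G] of the node [a], the frequency [G * q a] brings [t] back to
    the arc of half-width [eta] around [0] only on [O(q a)] intervals of length
    [2 * eta / (G * q a)]: the total length over the [G] nodes does not depend on
    [G] or [q]. *)
Lemma resonance_set (G : nat) (q : nat -> nat) (eta : R) :
  (2 <= G)%N -> (forall a, (0 < q a)%N) -> 0 < eta -> eta <= 2 * pi ->
  exists B : set R, [/\ measurable B, (mu B <= (42 * eta)%:E)%E &
    forall t, t \in `[0, 2 * pi[ -> ~ B t -> forall a, (a < G)%N ->
      far (t - a%:R * (2 * pi / G%:R)) (4 * pi / G%:R) \/
      far ((G * q a)%N%:R * t) eta].
Proof.
move=> G2 q0 eta0 etapi; have p0 := pi_gt0 R.
have GR : (0 : R) < G%:R by rewrite ltr0n; lia.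
have qR a : (0 : R) < (q a)%:R by rewrite ltr0n.
pose f a : R := (G * q a)%N%:R.
have fR a : 0 < f a by rewrite /f natrM mulr_gt0.
(* [w - 1] is the number of turns between [t] and the node *)
pose ix a w i : int := (q a * a)%N%:Z + (G * q a)%N%:Z * (w%:Z - 1) - (q a).*2%:Z - 1 + i%:Z.
pose ctr a w i : R := (ix a w i)%:~R * (2 * pi) / f a.
pose I a w i : set R := itv_around (ctr a w i) (eta / f a).
pose B2 a w := \big[setU/set0]_(i < 4 * q a + 3) I a w i.
pose B1 a := \big[setU/set0]_(w < 3) B2 a w.
pose B := \big[setU/set0]_(a < G) B1 a.
have mI a w i : measurable (I a w i) by exact: measurable_itv.
have mB2 a w : measurable (B2 a w) by exact: measurable_bigU.
have mB1 a : measurable (B1 a) by exact: measurable_bigU.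
exists B; split; first exact: measurable_bigU.
- have h2 a w : (mu (B2 a w) <= ((4 * q a + 3)%N%:R * (2 * (eta / f a)))%:E)%E.
    apply: measure_bigU_le => // i _; apply: measure_itv_around.
    by rewrite divr_ge0// ltW.
  have h1 a : (mu (B1 a) <= (3%:R * ((4 * q a + 3)%N%:R * (2 * (eta / f a))))%:E)%E.
    by apply: measure_bigU_le.
  have h0 : (mu B <= (G%:R * (42 * eta / G%:R))%:E)%E.
    apply: measure_bigU_le => // a _; apply: le_trans (h1 a) _; rewrite lee_fin.
    have -> : 42 * eta / G%:R = 3 * (7 * (q a)%:R * (2 * (eta / f a))) :> R.
      by rewrite /f natrM; field; rewrite !gt_eqF.
    rewrite ler_pM2l// ler_pM2r; last by rewrite mulr_gt0// divr_gt0.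
    by rewrite -natrM ler_nat; have := q0 a; lia.
  by apply: le_trans h0 _; rewrite mulrCA mulfV ?gt_eqF// mulr1.
- move=> t ht nB a aG; apply: contrapT => /not_orP[/not_far[w hw] /not_far[j hj]].
  apply: nB; rewrite /B -bigcup_mkord; exists a => //; rewrite /B1 -bigcup_mkord.
  move: ht; rewrite in_itv /= => /andP[t0 t1].
  set tau := a%:R * (2 * pi / G%:R) in hw.
  have tau0 : 0 <= tau by rewrite mulr_ge0// divr_ge0 ?ltW// mulr_gt0.
  have tau1 : tau < 2 * pi.
    by rewrite /tau mulrCA gtr_pMr ?mulr_gt0// ltr_pdivrMr// mul1r ltr_nat.
  have g4 : 4 * pi / G%:R <= 2 * pi :> R.
    rewrite ler_pdivrMr//; have : (2 : R) <= G%:R by rewrite (ler_nat _ 2).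
    by move=> ?; nra.
  have [w1 w2] : (-2 < w /\ w < 2)%R.
    move: hw; rewrite ltr_norml => /andP[u1 u2].
    have v1 : - 2 < w%:~R :> R by rewrite -(ltr_pM2r (_ : 0 < 2 * pi)) ?mulr_gt0//; lra.
    have v2 : w%:~R < 2 :> R by rewrite -(ltr_pM2r (_ : 0 < 2 * pi)) ?mulr_gt0//; lra.
    by split; [move: v1; rewrite -(intrN _ 2%:Z)|move: v2]; rewrite ?(ltr_int _ _ 2%:Z) ?ltr_int.
  have [hwn ew] := turn_index w1 w2.
  exists `|(w + 1)%R|%N => //; rewrite /B2 -bigcup_mkord.
  (* the index of the multiple of [2 * pi / f a] that is close to [t] *)
  pose i : int := j - (ix a `|(w + 1)%R|%N 0).
  have hj' : `|t - j%:~R * (2 * pi) / f a| < eta / f a.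
    have -> : t - j%:~R * (2 * pi) / f a = (f a * t - j%:~R * (2 * pi)) / f a.
      by rewrite mulrBl [f a * t]mulrC mulfK// gt_eqF.
    by rewrite normrM normfV (gtr0_norm (fR a)) ltr_pM2r ?invr_gt0.
  pose k : int := j - (q a * a)%N%:Z - (G * q a)%N%:Z * w.
  have hk : `|k%:~R * (2 * pi) / f a| < 4 * pi / G%:R + eta / f a.
    have -> : k%:~R * (2 * pi) / f a =
        (t - tau - w%:~R * (2 * pi)) - (t - j%:~R * (2 * pi) / f a).
      rewrite /k /tau /f !intrB intrM -!pmulrn !natrM; field.
      by rewrite !gt_eqF.
    by apply: le_lt_trans (ler_normB _ _) _; exact: ltrD.
  have hk2 : `|k%:~R| < (q a).*2.+1%:R :> R.
    have e1 : 4 * pi / G%:R + eta / f a <= (q a).*2.+1%:R * (2 * pi / f a).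
      have -> : (q a).*2.+1%:R = 2 * (q a)%:R + 1 :> R by rewrite -natr1 -mul2n natrM.
      rewrite (mulrDl (2 * (q a)%:R) 1) (mul1r (_ / f a)); apply: lerD.
        rewrite /f natrM le_eqVlt; apply/orP; left; apply/eqP; field.
        by rewrite !gt_eqF.
      by rewrite ler_pM2r ?invr_gt0.
    move: (lt_le_trans hk e1).
    rewrite -mulrA normrM (gtr0_norm (_ : 0 < 2 * pi / f a)) ?divr_gt0 ?mulr_gt0//.
    by rewrite ltr_pM2r// divr_gt0// mulr_gt0.
  have hk3 : (`|k| < (q a).*2.+1)%N.
    move: hk2; rewrite -intr_norm -[(q a).*2.+1%:R]/((q a).*2.+1%:Z%:~R) ltr_int.
    by rewrite -abszE.
  have ei : i = k + (q a).*2%:Z + 1 by rewrite /i /ix ew /k; ring.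
  have [hi ai] := window_index hk3 ei.
  exists `|i|%N; first exact: hi.
  rewrite /I /itv_around /= in_itv /= /ctr.
  have -> : ix a `|(w + 1)%R|%N `|i|%N = j by rewrite /ix ai /i /ix; ring.
  by move: hj'; rewrite ltr_norml => /andP[u1 u2]; apply/andP; split; lra.
Qed.

End BadSet.

(** * One step of the construction *)

Section Step.
Variable R : realType.
Notation nm := (@Normc.normc R).
Notation mu := (@lebesgue_measure R).
Implicit Types (t : R).

Lemma sym_partial_sum_le (c : int -> R[i]) t d :
  nm (sym_partial_sum c t d) <= symsum d (fun n => nm (c n)).
Proof.
apply: le_trans (nm_sum _ _ _) _; apply: ler_sum => k _.
by rewrite nmM nm_expi mulr1.
Qed.

Lemma sym_partial_sum_lip (c : int -> R[i]) t t' d :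
  nm (sym_partial_sum c t d - sym_partial_sum c t' d) <=
  symsum d (fun n => nm (c n) * `|n%:~R|) * `|t - t'|.
Proof.
rewrite /sym_partial_sum -sumrB -symsumZr; apply: le_trans (nm_sum _ _ _) _.
apply: ler_sum => k _; rewrite -mulrBr nmM -mulrA ler_wpM2l ?nm_ge0//.
by rewrite nm_expiB -mulrBr -normrM; exact: chord_lip.
Qed.

Lemma sym_partial_sumE (c : int -> R[i]) t N :
  sym_partial_sum c t N = symsum N (fun n => c n * expi (n%:~R * t)).
Proof. by []. Qed.

Lemma sym_partial_sumD (c c' : int -> R[i]) t N :
  sym_partial_sum (fun n => c n + c' n) t N =
  sym_partial_sum c t N + symsum N (fun n => c' n * expi (n%:~R * t)).
Proof.
by rewrite !sym_partial_sumE -symsumD; apply: eq_symsum => k _; rewrite mulrDl.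
Qed.

(** A localized kernel normalized to mean one.  The bound [g] on its coefficients
    is independent of [delta]; this is what the small nodes require. *)
Lemma exists_bounded_multiplier g (delta : R) : (2 <= g)%N -> 0 < delta ->
  exists N (y : int -> R[i]),
  [/\ y 0 = 1, forall j, nm (y j) <= 1, forall j, (N < `|j|)%N -> y j = 0,
      symsum N (fun j => nm (y j)) <= g%:R &
      forall x, far x (4 * pi / g%:R) ->
        nm (symsum N (fun j => y j * expi (j%:~R * x))) <= delta].
Proof.
move=> g2 d0; have gR : (0 : R) < g%:R by rewrite ltr0n; lia.
have k0 : 0 < delta / g%:R by rewrite divr_gt0.
have [D [th [Th K]]] := exists_localized_kernel g2 k0.
pose y (j : int) : R[i] := if (`|j| <= D)%N then (g%:R * th j)%:C else 0.
have ny j : nm (y j) <= g%:R * th j.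
  rewrite /y; case: ifP => _; last by rewrite nm0 mulr_ge0 ?(lk_ge0 K)// ltW.
  by rewrite nm_real ger0_norm// mulr_ge0 ?(lk_ge0 K)// ltW.
exists D, y; split.
- by rewrite /y /= (lk_zero K) mulfV ?gt_eqF.
- move=> j; apply: le_trans (ny j) _.
  by rewrite mulrC -ler_pdivlMr// mul1r (lk_le K).
- by move=> j; rewrite ltnNge /y => /negbTE ->.
- apply: le_trans (ler_symsum (fun j _ => ny j)) _.
  by rewrite symsumZ ler_piMr ?(ltW gR)// (lk_sum K).
- move=> x fx; rewrite (@eq_symsum _ _ _ (fun j => g%:R%:C * ((th j)%:C * expi (j%:~R * x)))).
    rewrite symsumZ (lk_eval K) -realCM nm_real ger0_norm; last first.
      by rewrite mulr_ge0 ?(lk_val_ge0 K)// ltW.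
    by rewrite mulrC -ler_pdivlMr// (lk_far K).
  by move=> j hj; rewrite /y hj realCM mulrA.
Qed.

Lemma exists_nat_gt (x : R) : exists n : nat, x < n%:R.
Proof. by exists (Num.truncn x).+1; exact: Num.Theory.truncnS_gt. Qed.

(** The number of nodes is chosen once the multipliers, hence [BA], are known, and
    the accuracy of the kernel after the number of nodes. *)
Lemma exists_parameters (s Lam BA rho ch r' eps : R) :
  0 <= s -> 0 <= Lam -> 0 <= BA -> 0 < rho -> 0 < ch -> 0 < r' -> 0 < eps ->
  exists G (kappa : R), [/\ (2 <= G)%N, 0 < kappa &
    [/\ 4 * pi / G%:R <= rho, Lam * (4 * pi / G%:R) <= r' / 4,
        G%:R * (kappa * (s * (2 + BA))) <= r' / 4 &
        G%:R * (s * kappa * BA) + 2 * (s * BA * (2 / G%:R / ch)) <= eps]].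
Proof.
move=> s0 Lam0 BA0 rho0 ch0 r'0 eps0; have p0 := pi_gt0 R.
pose X1 := 4 * pi / rho; have X1p : 0 <= X1 by rewrite divr_ge0 ?mulr_ge0 ?ltW.
pose X2 := 4 * (Lam * (4 * pi)) / r'.
have X2p : 0 <= X2.
  apply: divr_ge0; last exact: ltW.
  by do 3![apply: mulr_ge0 => //]; exact: ltW.
pose X3 := 8 * (s * BA) / (ch * eps).
have X3p : 0 <= X3.
  by apply: divr_ge0; do 2?[apply: mulr_ge0 => //]; exact: ltW.
have [G hG] := exists_nat_gt (2 + X1 + X2 + X3).
have G2 : (2 <= G)%N by rewrite -(ltr_nat R); lra.
have GR : (0 : R) < G%:R by rewrite ltr0n; exact: ltnW.
have [X1G X2G X3G] : [/\ X1 <= G%:R, X2 <= G%:R & X3 <= G%:R] by split; lra.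
pose e0 := Num.min eps r'.
have e00 : 0 < e0 by rewrite lt_min eps0.
have e01 : e0 <= eps by rewrite ge_min lexx.
have e02 : e0 <= r' by rewrite ge_min lexx orbT.
pose Q := G%:R * ((s + 1) * (2 + BA)).
have Q0 : 0 < Q by rewrite mulr_gt0// mulr_gt0//; lra.
have kap0 : 0 < e0 / (4 * Q) by rewrite divr_gt0// mulr_gt0.
have h4 : G%:R * (e0 / (4 * Q) * (s * (2 + BA))) <= e0 / 4.
  have -> : e0 / 4 = e0 / (4 * Q) * Q by field; rewrite gt_eqF.
  by rewrite /Q mulrCA ler_pM2l// ler_pM2l// ler_wpM2r//; lra.
have h5 : G%:R * (s * (e0 / (4 * Q)) * BA) <= e0 / 4.
  by apply: le_trans h4; rewrite ler_pM2l// mulrAC mulrC ler_pM2l// ler_wpM2l//; lra.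
exists G, (e0 / (4 * Q)); split => //; split.
- have -> : 4 * pi / G%:R = X1 * rho / G%:R.
    by rewrite /X1; field; rewrite !gt_eqF.
  by rewrite ler_pdivrMr// mulrC ler_pM2l.
- have -> : Lam * (4 * pi / G%:R) = X2 * (r' / 4) / G%:R.
    by rewrite /X2; field; rewrite !gt_eqF.
  by rewrite ler_pdivrMr// mulrC ler_pM2l ?divr_gt0.
- lra.
have h3 : 2 * (s * BA * (2 / G%:R / ch)) <= eps / 2.
  have -> : 2 * (s * BA * (2 / G%:R / ch)) = X3 * (eps / 2) / G%:R.
    by rewrite /X3; field; rewrite !gt_eqF.
  by rewrite ler_pdivrMr// mulrC ler_pM2l ?divr_gt0.
lra.
Qed.

(** The bound on the exceptional set involves only [g], and the bounds on the cost
    and on the partial sums only [r], [g] and [eps], although the construction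
    depends on [c] and on the target [r'].  This uniformity lets [r] and [g] be
    fixed in advance at each stage of an iteration. *)
Lemma step (c : int -> R[i]) (d : nat) (r r' eps : R) (g : nat) :
  (forall n, (d < `|n|)%N -> c n = 0) ->
  0 < r -> 0 < r' -> 0 < eps -> (2 <= g)%N ->
  exists c' d' (B : set R),
  [/\ (d < d')%N, forall n, (d' < `|n|)%N -> c' n = 0,
      forall n, (`|n| <= d)%N -> c' n = c n &
      forall L, \sum_(k < L) nm (c' (Negz k) - c (Negz k)) ^+ 2 <= r ^+ 2 * g%:R] /\
  [/\ measurable B, (mu B <= (42 * (4 * pi / g%:R))%:E)%E,
      forall t, t \in `[0, 2 * pi[ -> ~ B t -> nm (sym_partial_sum c' t d') <= r' &
      forall t, nm (sym_partial_sum c t d) <= r / 2 -> forall N,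
        nm (sym_partial_sum c' t N - sym_partial_sum c t N) <= r * (g%:R + 2) + eps].
Proof.
move=> supp r0 r'0 eps0 g2; have p0 := pi_gt0 R.
have gR : (0 : R) < g%:R by rewrite ltr0n; lia.
pose s := symsum d (fun n => nm (c n)).
pose Lam := symsum d (fun n => nm (c n) * `|n%:~R|).
have s0 : 0 <= s by apply: symsum_ge0 => n; exact: nm_ge0.
have Lam0 : 0 <= Lam by apply: symsum_ge0 => n; rewrite mulr_ge0 ?nm_ge0.
have S_le t : nm (sym_partial_sum c t d) <= s by exact: sym_partial_sum_le.
have S_lip t t' : nm (sym_partial_sum c t d - sym_partial_sum c t' d) <= Lam * `|t - t'|.
  exact: sym_partial_sum_lip.
pose dR := r' / (4 * r); have dR0 : 0 < dR by rewrite divr_gt0// mulr_gt0.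
pose dA := r' / (4 * (s + 1)).
have dA0 : 0 < dA by rewrite divr_gt0// mulr_gt0//; lra.
have [NR [yK [yK0 yK1 yKN yKs yKv]]] := exists_bounded_multiplier g2 dR0.
have [NA [yA [yA0 yAneg yAN yAv]]] := exists_analytic_multiplier g2 dA0.
pose J := maxn NR NA.
pose BA := symsum J (fun j => nm (yK j)) + symsum J (fun j => nm (yA j)).
have BR0 : 0 <= symsum J (fun j => nm (yK j)) by apply: symsum_ge0 => j; exact: nm_ge0.
have BA0 : 0 <= symsum J (fun j => nm (yA j)) by apply: symsum_ge0 => j; exact: nm_ge0.
have yKJ : symsum J (fun j => nm (yK j)) <= g%:R.
  rewrite (@symsum_widen _ NR) ?leq_maxl// => j jN; by rewrite yKN// nm0.
have BA1 : symsum J (fun j => nm (yK j)) <= BA by rewrite lerDl.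
have BA2 : symsum J (fun j => nm (yA j)) <= BA by rewrite lerDr.
have BApos : 0 <= BA by rewrite addr_ge0.
(* two points at distance [rho] have values of [S] within [r / 2] *)
pose rho := Num.min pi (r / (2 * (Lam + 1))).
have rho1 : rho <= pi by rewrite ge_min lexx.
have rho0 : 0 < rho by rewrite lt_min p0 divr_gt0// mulr_gt0//; lra.
have rhoL : Lam * rho <= r / 2.
  have h : rho <= r / (2 * (Lam + 1)) by rewrite ge_min lexx orbT.
  apply: (@le_trans _ _ ((Lam + 1) * rho)); first by rewrite ler_pM2r//; lra.
  by move: h; rewrite invfM mulrA ler_pdivlMr//; [rewrite mulrC|lra].
have ch0 : 0 < chord (rho / 2).
  by apply: chord_gt0; rewrite ?divr_gt0// ler_pdivrMr// (le_trans rho1)// ler_peMr ?ltW// ltr1n.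
have [G [kappa [G2 kap0 [h1 h2 h3 h4]]]] :=
  exists_parameters s0 Lam0 BApos rho0 ch0 r'0 eps0.
have [D [theta [Th K]]] := exists_localized_kernel G2 kap0.
(* [m] is a multiple of [G], so that the nodes are commensurable with the
   periods of all the frequencies [m * (J + 1) ^ a = G * q a] *)
pose q a := ((d + D.*2).+1 * J.+1 ^ a)%N.
pose m := (G * (d + D.*2).+1)%N.
have hm : (d + D.*2 < m)%N by rewrite /m; apply: leq_pmull; exact: ltnW.
have q0 a : (0 < q a)%N by rewrite /q muln_gt0 expn_gt0.
have eta0 : 0 < 4 * pi / g%:R :> R by rewrite divr_gt0// mulr_gt0.
have eta1 : 4 * pi / g%:R <= 2 * pi :> R.
  have -> : 4 * pi = 2 * pi * 2 :> R by ring.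
  by rewrite ler_pdivrMr// ler_pM2l ?mulr_gt0// (ler_nat _ 2).
have [B [mB muB hB]] := resonance_set G2 q0 eta0 eta1.
pose inc := increment c d r G D theta J yK yA m.
have kap00 := ltW kap0.
exists (fun n => c n + inc n), (top_degree G D J m), B; split; split => //.
- exact: top_degree_gt.
- move=> n hn; rewrite supp; last by apply: ltn_trans hn; exact: top_degree_gt.
  by rewrite add0r; exact: increment_high.
- by move=> n hn; rewrite [inc n]increment_low// addr0.
- move=> L; under eq_bigr do rewrite addrC addKr.
  exact: (sum_neg_increment c r0 G2 K yK1 yKJ yAneg hm).
- move=> t ht nB; rewrite sym_partial_sumD.
  have -> : sym_partial_sum c t (top_degree G D J m) = sym_partial_sum c t d.
    rewrite !sym_partial_sumE; apply: symsum_widen => [|n hn].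
      exact/ltnW/top_degree_gt.
    by rewrite supp// mul0r.
  apply: (new_value_le (eta := 4 * pi / g%:R) (dR := dR) (dA := dA) S_le S_lip r0
    kap00 K yK0 yA0 BA1 BA2).
  + move=> x fx; rewrite /multiplier_value (@symsum_widen _ NR) ?leq_maxl ?yKv// => j jN.
    by rewrite yKN// mul0r.
  + move=> x fx; rewrite /multiplier_value (@symsum_widen _ NA) ?leq_maxr ?yAv// => j jN.
    by rewrite yAN// mul0r.
  + exact: ltW.
  + exact: ltW.
  + have h6 : r * dR = r' / 4 by rewrite /dR; field; rewrite gt_eqF.
    have h7 : s * dA <= r' / 4.
      have -> : r' / 4 = (s + 1) * dA.
        by rewrite /dA; field; rewrite gt_eqF// ltr_wpDl.
      by rewrite ler_pM2r// lerDl.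
    have -> : r' = r' / 4 + r' / 4 + r' / 4 + r' / 4 by field.
    by rewrite h6; do 2![apply: lerD => //]; exact: lerD.
  + move=> a aG; have := hB t ht nB a aG; congr (_ \/ far (_%:R * _) _).
    by rewrite /q /m mulnA.
- move=> t ht N; rewrite sym_partial_sumD [X in nm X]addrC addKr.
  apply: (partial_sum_le S_le S_lip r0 G2 kap00 K yK1 yKJ BA2 hm
    N h1 rho1 rhoL h4 ht).
Qed.

End Step.

(** * Iteration and convergence *)

Section Limit.
Variable R : realType.
Notation nm := (@Normc.normc R).
Notation mu := (@lebesgue_measure R).
Implicit Types (t : R).

Lemma sum_half_lt (n : nat) : \sum_(i < n) ((2 : R) ^+ i)^-1 <= 2.
Proof.
suff -> : \sum_(i < n) ((2 : R) ^+ i)^-1 = 2 - 2 * (2 ^+ n)^-1.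
  by rewrite gerBl mulr_ge0// invr_ge0 exprn_ge0.
elim: n => [|n IH]; first by rewrite big_ord0 expr0 invr1; lra.
rewrite big_ord_recr /= IH exprS; field; rewrite expf_neq0//.
Qed.

Lemma nneseries_le (u : nat -> \bar R) (b : R) : (forall n, (0 <= u n)%E) ->
  (forall n, (\sum_(i < n) u i <= b%:E)%E) -> (\sum_(i <oo) u i < +oo)%E.
Proof.
move=> u0 ub; apply: (@le_lt_trans _ _ b%:E); last exact: ltry.
apply: lime_le; first by apply: is_cvg_nneseries => i _ _.
by apply: nearW => n; rewrite big_mkord.
Qed.

Lemma cvg_complex0 (f : nat -> R[i]) :
  (forall e : R, 0 < e -> exists N, forall n, (N <= n)%N -> nm (f n) <= e) ->
  ((f : nat -> R[i]^o) @ \oo --> (0 : R[i]^o)).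
Proof.
move=> h; apply/cvgrPdist_le => e e0.
have [x ex] : exists x : R, e = x%:C.
  by exists (complex.Re e); move: e0; rewrite ltcE /= => /andP[/eqP]; case: e => a b /= ->.
rewrite ex ltcR in e0; have [N hN] := h x e0.
exists N => // n /= Nn; rewrite sub0r normrN ex normCE lecR; exact: hN.
Qed.

(** At stage [k] the kernel has [g = 2 ^ k.+1]; this threshold makes the partial
    sums of the stage [O(2 ^- k)] and its cost summable. *)
Definition radius (k : nat) : R := (2 ^+ k * ((2 ^ k.+1)%N%:R + 2))^-1.

Lemma radius_gt0 k : 0 < radius k.
Proof. by rewrite invr_gt0 mulr_gt0 ?exprn_gt0// ltr_wpDl. Qed.

Lemma radius_mul k : radius k * ((2 ^ k.+1)%N%:R + 2) = (2 ^+ k)^-1.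
Proof.
by rewrite /radius invfM -mulrA mulVf ?mulr1// gt_eqF// ltr_wpDl.
Qed.

Lemma radius_le k : radius k <= (2 ^+ k)^-1.
Proof.
rewrite -radius_mul ler_peMr ?(ltW (radius_gt0 k))//.
by have : (0 : R) <= (2 ^ k.+1)%N%:R by []; lra.
Qed.

Lemma radius_cost k : radius k ^+ 2 * (2 ^ k.+1)%N%:R <= (2 ^+ k)^-1.
Proof.
have r0 := radius_gt0 k.
have h0 : (0 : R) <= (2 ^ k.+1)%N%:R by [].
have h1 : radius k <= 1.
  by apply: le_trans (radius_le k) _; rewrite invf_le1 ?exprn_gt0// exprn_ege1// ler1n.
rewrite expr2 -mulrA; apply: (@le_trans _ _ (radius k * (2 ^ k.+1)%N%:R)).
  by rewrite ler_piMl// mulr_ge0// ltW.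
by rewrite -radius_mul ler_pM2l//; lra.
Qed.

Let state := {x : (int -> R[i]) * nat | forall n, (x.2 < `|n|)%N -> x.1 n = 0}.
Implicit Types x : state.
Let co x := (sval x).1.
Let dg x := (sval x).2.

Let step_ok (p : nat * state) (q : state * set R) :=
  let k := p.1 in let x := p.2 in let x' := q.1 in let B := q.2 in
  [/\ (dg x < dg x')%N,
      forall n, (`|n| <= dg x)%N -> co x' n = co x n &
      forall L, \sum_(i < L) nm (co x' (Negz i) - co x (Negz i)) ^+ 2 <= (2 ^+ k)^-1] /\
  [/\ measurable B, (mu B <= (21 * (4 * pi) / 2 ^+ k)%:E)%E,
      forall t, t \in `[0, 2 * pi[ -> ~ B t ->
        nm (sym_partial_sum (co x') t (dg x')) <= radius k.+1 / 2 &
      forall t, nm (sym_partial_sum (co x) t (dg x)) <= radius k / 2 -> forall N,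
        nm (sym_partial_sum (co x') t N - sym_partial_sum (co x) t N) <= 2 * (2 ^+ k)^-1].

Lemma step_exists p : exists q, step_ok p q.
Proof.
case: p => k [[c d] /= supp].
have g2 : (2 <= 2 ^ k.+1)%N by rewrite -{1}(expn1 2) leq_exp2l.
have e0 : 0 < ((2 : R) ^+ k)^-1 by rewrite invr_gt0 exprn_gt0.
have r1 : 0 < radius k.+1 / 2 by rewrite divr_gt0// radius_gt0.
have [c' [d' [B [[h1 h2 h3 h4] [h5 h6 h7 h8]]]]] := step supp (radius_gt0 k) r1 e0 g2.
exists (exist _ (c', d') h2, B); split; split => //=.
- by move=> L; apply: le_trans (h4 L) (radius_cost k).
- apply: le_trans h6 _; rewrite lee_fin natrX exprS le_eqVlt; apply/orP; left; apply/eqP.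
  by field; rewrite expf_neq0.
- move=> t ht N; apply: le_trans (h8 t ht N) _; rewrite radius_mul; lra.
Qed.

(** Each stage only adds frequencies above the degree of the previous one, so the
    coefficients stabilize, and the constant coefficient stays [1].  By the Borel-Cantelli lemma almost every [t] eventually avoids the
    exceptional sets: from then on every stage is small at [t], and so are the
    partial sums between two stages. *)
Lemma exists_null_series_small_negative_part :
  exists c : int -> R[i], null_series c /\
    (\esum_(n in [set n : int | (n < 0)%R]) ((nm (c n)) ^+ 2)%:E < +oo)%E.
Proof.
have [F hF] := choice step_exists.
pose c0 (n : int) : R[i] := if n == 0 then 1 else 0.
have supp0 (n : int) : ((c0, 0%N).2 < `|n|)%N -> (c0, 0%N).1 n = 0.
  by rewrite /= absz_gt0 /c0 => /negbTE ->.
pose x0 : state := exist _ (_, _) supp0.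
pose u k : state := iteri k (fun i x => (F (i, x)).1) x0.
pose B k : set R := (F (k, u k)).2.
have hu k : step_ok (k, u k) (u k.+1, B k).
  by have := hF (k, u k); rewrite /B /=; case: (F _).
have dS k : (dg (u k) < dg (u k.+1))%N by have [[? ? ?] _] := hu k.
have dle k l : (k <= l)%N -> (dg (u k) <= dg (u l))%N.
  by move/subnK <-; elim: (l - k)%N => [//|i IH]; apply: leq_trans IH (ltnW (dS _)).
have dge k : (k <= dg (u k))%N.
  by elim: k => [//|k IH]; apply: leq_ltn_trans IH (dS k).
have agree k l n : (k <= l)%N -> (`|n| <= dg (u k))%N -> co (u l) n = co (u k) n.
  move=> /subnK <- hn; elim: (l - k)%N => [//|i IH]; rewrite -IH addSn.
  have [[_ h _] _] := hu (i + k)%N; apply: h; apply: leq_trans hn _.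
  by apply: dle; exact: leq_addl.
pose c (n : int) := co (u `|n|%N) n.
have cE k n : (`|n| <= dg (u k))%N -> c n = co (u k) n.
  move=> hn; rewrite /c; case: (leqP `|n|%N k) => [h|/ltnW h]; last exact: agree.
  by rewrite (agree `|n|%N k n).
have cpsE k t N : (N <= dg (u k))%N -> sym_partial_sum c t N = sym_partial_sum (co (u k)) t N.
  move=> hN; rewrite !sym_partial_sumE; apply: eq_symsum => n hn.
  by rewrite (cE k)// (leq_trans hn).
have psE k t N : (dg (u k) <= N)%N ->
    sym_partial_sum (co (u k)) t N = sym_partial_sum (co (u k)) t (dg (u k)).
  move=> hN; rewrite !sym_partial_sumE; apply: symsum_widen => // n hn.
  by rewrite /co (svalP (u k)) ?mul0r.
exists c; split; [split|].
- by exists 0; rewrite /c /= oner_eq0.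
- exists (lim_sup_set B); split.
  + apply: bigcap_measurable => // i _; apply: bigcup_measurable => j _.
    by have [_ []] := hu j.
  + apply: lim_sup_set_cvg0 => [j|]; first by have [_ []] := hu j.
    apply: (@nneseries_le _ (21 * (4 * pi) * 2)) => [//|n].
    apply: (@le_trans _ _ (\sum_(i < n) (21 * (4 * pi) / 2 ^+ i)%:E)%E).
      by apply: lee_sum => i _; have [_ []] := hu i.
    rewrite sumEFin lee_fin -mulr_sumr ler_wpM2l ?sum_half_lt//.
    by rewrite !mulr_ge0// pi_ge0.
  + move=> t /= nt; apply: contrapT => nls; apply: nt => ht.
    have [K hK] : exists K, forall k, (K <= k)%N -> ~ B k t.
      apply: contrapT => nK; apply: nls => K _.
      apply: contrapT => nb; apply: nK; exists K => k Kk Bk; apply: nb.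
      by exists k.
    have hS k : (K < k)%N -> nm (sym_partial_sum (co (u k)) t (dg (u k))) <= radius k / 2.
      by case: k => // k Kk; have [_ [_ _ h _]] := hu k; apply: h => //; exact: hK.
    apply: cvg_complex0 => e e0.
    (* the partial sums from stage [k] on are at most [3 * 2 ^- k] *)
    have [K' hK'] : exists K', 3 * ((2 : R) ^+ K')^-1 <= e.
      have [n hn] := @exists_expr_le R 2^-1 (e / 3) ltac:(by []) ltac:(lra) ltac:(lra).
      by exists n; move: hn; rewrite exprVn; lra.
    exists (dg (u (maxn K.+1 K'))) => N hN.
    (* the stage [k] such that [N] lies between the degrees of [u k] and [u k.+1] *)
    have exN : exists k, (N < dg (u k.+1))%N by exists N; exact: dge.
    have [k Nk kmin] := ex_minnP exN.
    have kM : (maxn K.+1 K' <= k)%N.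
      by rewrite leqNgt; apply/negP => /dle h; have := leq_trans h hN; rewrite leqNgt Nk.
    have kN : (dg (u k) <= N)%N.
      case: k {Nk} kM kmin => [|k] kM kmin; first by rewrite geq_max in kM.
      by rewrite leqNgt; apply/negP => /kmin; rewrite ltnn.
    have [Kk K'k] : (K < k)%N /\ (K' <= k)%N by move: kM; rewrite geq_max => /andP[].
    have h1 := hS k Kk; have [_ [_ _ _ h2]] := hu k; have {h2}h2 := h2 t h1 N.
    rewrite (cpsE k.+1) ?(ltnW Nk)//; rewrite /= (psE k t N kN) in h2.
    have h3 := nmB_le (sym_partial_sum (co (u k.+1)) t N) (sym_partial_sum (co (u k)) t (dg (u k))).
    have h4 := radius_le k; have h5 := radius_gt0 k.
    have h6 : ((2 : R) ^+ k)^-1 <= (2 ^+ K')^-1.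
      by rewrite lef_pV2 ?posrE ?exprn_gt0// ler_eXn2l// ltr1n.
    lra.
- have bound k L : \sum_(i < L) nm (co (u k) (Negz i)) ^+ 2 <= 2.
    apply: le_trans (sum_half_lt k); elim: k => [|k IH].
      by rewrite big_ord0 big1 // => i _; rewrite -[co _ _]/(0 : R[i]) nm0 expr0n.
    rewrite big_ord_recr /=; have [[_ ag h] _] := hu k.
    apply: le_trans (lerD IH (h L)); rewrite -big_split /=; apply: ler_sum => i _.
    (* the coefficients of [u k] and of its increment have disjoint supports *)
    case: (leqP `|Negz i|%N (dg (u k))) => hi.
      by rewrite ag// subrr nm0 expr0n addr0.
    by rewrite [co (u k) _](svalP (u k))// subr0 nm0 expr0n add0r.
  rewrite (@reindex_esum _ _ _ setT _ Negz); last first.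
    split => //; first by move=> x y _ _ [].
    by case=> // n _; exists n.
  rewrite -nneseries_esumT => [|n]; last by rewrite lee_fin sqr_ge0.
  apply: (@nneseries_le _ 2) => [n|L]; first by rewrite lee_fin sqr_ge0.
  rewrite sumEFin lee_fin; apply: le_trans (bound L L); apply: ler_sum => i _.
  by rewrite (cE L)//; apply: leq_trans (dge L); have := ltn_ord i; lia.
Qed.

End Limit.

Theorem theorem1 (R : realType) :
  exists c : int -> R[i],
    null_series c /\
    (\esum_(n in [set n : int | (n < 0)%R]) ((Normc.normc (c n)) ^+ 2)%:E
       < +oo)%E.
Proof. exact: exists_null_series_small_negative_part. Qed.
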